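(* Let $d\ge 3$. For every $f\in \mathcal{O}(\mathbb{C}^2)_{d,\Delta}$ the associated form $A(f)$ lies in $\mathcal{O}(\mathbb{C}^2)_{2(d-2),\mathrm{Cat}}$, i.e. the morphism $A$ maps $\mathcal{O}(\mathbb{C}^2)_{d,\Delta}$ to $\mathcal{O}(\mathbb{C}^2)_{2(d-2),\mathrm{Cat}}$. Moreover, for every regular $\mathrm{GL}_2$-invariant function $I$ on $\mathcal{O}(\mathbb{C}^2)_{d,\Delta}$ there exists a regular $\mathrm{GL}_2$-invariant function $J$ on $\mathcal{O}(\mathbb{C}^2)_{2(d-2),\mathrm{Cat}}$ such that $I=J\circ A$.
   Context: For $j\ge 0$, $\mathcal{O}(\mathbb{C}^2)_j=\mathbb{C}[x,y]_j$ is the vector space of binary forms (homogeneous polynomials) of degree $j$ on $\mathbb{C}^2$. $\mathcal{O}(\mathbb{C}^2)_{d,\Delta}\subseteq\mathcal{O}(\mathbb{C}^2)_d$ is the affine open subvariety of forms with nonvanishing discriminant $\Delta$ (equivalently, $f_x,f_y$ have no common zero away from $0$). Associated form: for $f\in\mathcal{O}(\mathbb{C}^2)_{d,\Delta}$, let $M(f)=\mathbb{C}[x,y]/(f_x,f_y)$ be the Milnor algebra, a graded Artinian Gorenstein algebra whose socle is its one-dimensional component of degree $2(d-2)$, spanned by the image $\overline{\mathrm{hess}(f)}$ of the Hessian determinant $\mathrm{hess}(f)=f_{xx}f_{yy}-f_{xy}^2$. Let $\bar x,\bar y\in M(f)$ be the images of $x,y$. The form $A(f)$ of degree $2(d-2)$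 in variables $z_1,z_2$ (coordinates dual to $x,y$) is defined by $$(z_1\bar x+z_2\bar y)^{2(d-2)}=A(f)(z_1,z_2)\cdot\overline{\mathrm{hess}(f)}\in M(f).$$ Identifying $(\mathbb{C}^2)^\vee\cong\mathbb{C}^2$ (renaming $z_1,z_2$ as $x,y$) one regards $A$ as a morphism of affine varieties $A\colon\mathcal{O}(\mathbb{C}^2)_{d,\Delta}\to\mathcal{O}(\mathbb{C}^2)_{2(d-2)}$. Catalecticant: for $F=\sum_{i=0}^{2N}\binom{2N}{i}a_ix^{2N-i}y^i\in\mathcal{O}(\mathbb{C}^2)_{2N}$, $\mathrm{Cat}(F):=\det(a_{i+j})_{0\le i,j\le N}$. $\mathcal{O}(\mathbb{C}^2)_{2N,\mathrm{Cat}}$ is the affine open subvariety of $\mathcal{O}(\mathbb{C}^2)_{2N}$ where $\mathrm{Cat}\neq0$. Actions of $\mathrm{GL}_2$ (vectors are rows): $(gf)(x)=f(x\cdot g^{-t})$ on $\mathcal{O}(\mathbb{C}^2)_d$ and the dual action $(gF)(z)=F(z\cdot g)$ on $\mathcal{O}(\mathbb{C}^2)_{2(d-2)}$; a function is invariant under one type of action if and only if it is invariant under the other. *)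

(* Defs.v *)
From HB Require Import structures.
From mathcomp Require Import all_boot all_order all_algebra.
From mathcomp Require Import boolp classical_sets reals.
From mathcomp Require Import complex.
From mathcomp Require Import mpoly.

Set Implicit Arguments.
Unset Strict Implicit.
Unset Printing Implicit Defensive.

Import GRing.Theory.

Local Open Scope ring_scope.

Section BinaryForms.
Variable C : fieldType.
Implicit Types (f F : {mpoly C[2]}) (n d N : nat).

(* The variables x and y are 'X_0 and 'X_1; the same two variables also serve
   as the dual coordinates z_1 and z_2. *)
Definition ix : 'I_2 := ord0.
Definition iy : 'I_2 := ord_max.

(* The coefficient of x^(n-i) y^i in a binary form of degree n. *)
Definition bcoef n f (i : nat) : C :=
  f@_[multinom [tuple (n - i)%N; i]].

(* Row i < n of the Sylvester matrix of two forms p, q of degree n holds the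
   coefficients of p shifted i places to the right, row n + i those of q.  The
   format depends on n only, so that leading coefficients may vanish (unlike
   in mathcomp's [resultant] of univariate polynomials). *)
Definition sylvester_rows n (p : {mpoly C[2]}) : 'M[C]_(n, n + n) :=
  \matrix_(i < n, j < n + n)
    if (i <= j <= i + n)%N then bcoef n p (j - i) else 0.

Definition form_resultant n (p q : {mpoly C[2]}) : C :=
  \det (col_mx (sylvester_rows n p) (sylvester_rows n q)).

(* The normalisation is the classical one, which gives b^2 - 4ac for
   a x^2 + b x y + c y^2. *)
Definition discriminant d f : C :=
  (-1) ^+ 'C(d, 2) / d%:R ^+ (d - 2) *
  form_resultant d.-1 f^`M(ix) f^`M(iy).

Definition catalecticant N F : C :=
  \det (\matrix_(i < N.+1, j < N.+1)
          (bcoef (2 * N) F (i + j) / 'C(2 * N, i + j)%:R)).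

(* The principal affine open subset of the space of binary forms of degree n
   where h does not vanish; h is meant to be a polynomial in the coefficients
   of the form. *)
Definition principal_open n (h : {mpoly C[2]} -> C) : set {mpoly C[2]} :=
  [set f | f \is n.-homog /\ h f != 0].

Definition forms_disc d := principal_open d (discriminant d).

Definition forms_cat N := principal_open (2 * N) (catalecticant N).

(* The coordinate ring of a principal open subset is the localisation at h of
   the polynomial ring in the n+1 coefficients.  Only the values of phi on
   [principal_open n h] matter. *)
Definition regular_on n (h phi : {mpoly C[2]} -> C) : Prop :=
  exists (P : {mpoly C[n.+1]}) (k : nat),
    forall f, principal_open n h f ->
      phi f = P.@[fun i : 'I_n.+1 => bcoef n f i] / h f ^+ k.

(* f(x . M), where x is the row vector of the variables. *)
Definition row_subst (M : 'M[C]_2) f : {mpoly C[2]} :=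
  f \mPo [tuple \sum_(i < 2) M i j *: 'X_i | j < 2].

Definition gl_act (g : 'M[C]_2) f := row_subst (invmx g)^T f.

Definition gl_dual_act (g : 'M[C]_2) F := row_subst g F.

Definition gl_invariant_on (act : 'M[C]_2 -> {mpoly C[2]} -> {mpoly C[2]})
    (U : set {mpoly C[2]}) (phi : {mpoly C[2]} -> C) : Prop :=
  forall g f, g \in unitmx -> U f -> phi (act g f) = phi f.

Definition hessian f : {mpoly C[2]} :=
  f^`M(ix)^`M(ix) * f^`M(iy)^`M(iy) - f^`M(ix)^`M(iy) ^+ 2.

(* p and q have the same image in the Milnor algebra C[x,y]/(f_x, f_y). *)
Definition milnor_eq f (p q : {mpoly C[2]}) : Prop :=
  exists u v : {mpoly C[2]}, p - q = u * f^`M(ix) + v * f^`M(iy).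

Definition is_associated_form d f F : Prop :=
  F \is (2 * (d - 2)).-homog /\
  forall z : 'I_2 -> C,
    milnor_eq f ((z ix *: 'X_ix + z iy *: 'X_iy) ^+ (2 * (d - 2)))
                (F.@[z] *: hessian f).

(* When f has nonzero discriminant (and C has characteristic 0) there is
   exactly one F with [is_associated_form d f F]; 0 is the default value of
   the choice operator for other f. *)
Definition associated_form d f : {mpoly C[2]} :=
  xget 0 [set F | is_associated_form d f F].

End BinaryForms.

(* Main.v *)
(* Put n = d - 1, N = d - 2 and let B(f) be the Bezoutian of f_x and f_y, that
   is, the symmetric matrix of the form
   (f_x(u) f_y(v) - f_y(u) f_x(v)) / (u_1 v_2 - u_2 v_1) of bidegree (N, N).
   Its determinant is a nonzero multiple of the discriminant of f, and its
   restriction to the diagonal is a multiple of the Hessian.  A functional on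
   the forms of degree 2N that kills the Jacobian ideal has a Hankel matrix H
   such that H B(f) is scalar; applied to the associated form this gives
   H(A(f)) = n^-2 B(f)^-1.  Hence Cat(A(f)) <> 0, and the coefficients of
   f_x /\ f_y can be read off A(f) as polynomials divided by Cat(A(f)).
   Let now I = P / Delta^k be invariant.  Applying to the identity
   P(f(x . M)) = det(M)^w P(f), as polynomials in M, the SL_2-invariant pairing
   of the two rows of M writes P as a combination of bracket monomials in 2r
   copies of f, r = k n.  By the Pluecker relations (Kempe) one may assume that
   these are d-regular bipartite graphs, which have perfect matchings (Hall);
   contracting a perfect matching replaces the 2r copies of f by r copies of
   f_x /\ f_y.  So P is a combination of invariant polynomials in f_x /\ f_y,
   and the same combination evaluated at H(F)^-1 gives J. *)
Require Import Defs.
From HB Require Import structures.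
From mathcomp Require Import boolp classical_sets reals.
From mathcomp Require Import all_boot all_order all_algebra all_fingroup.
From mathcomp Require Import complex.
From mathcomp Require Import mpoly.
From mathcomp Require Import zify ring.

Set Implicit Arguments.
Unset Strict Implicit.
Unset Printing Implicit Defensive.

Import Order.TTheory GRing.Theory Num.Theory.

Local Open Scope ring_scope.

(** * Hall matchings *)

Section Permutations.

(** Forms are handled as symmetric tensors t |-> phi (wt t) on index functions with values in 'I_2,
    where phi lists the coefficients divided by binomials. A bracket then contracts one index of
    each of two factors, binomials arise by counting index functions, and a product of brackets is a
    matching of index positions, encoded by a permutation. The obstacle to pairing off the copies of
    f is that a regular graph need not have a perfect matching, while a bipartite regular one always
    does; hence the 2r copies are split into two arbitrary colour classes of r copies, and Kempe's
    reduction makes every bracket join the two colours. The number 2r = 2k(d-1) is the degree of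
    Delta^k in f. Contracting one bracket between two copies of f uses up one index of each and
    leaves the tensor of f_x /\ f_y, so what remains is again a matching between left and right
    blocks, with one position fewer in each. On the target side the adjugate of H(F) replaces its
    inverse, so that the only denominators are powers of Cat. Polynomial identities are proved by
    evaluation, which is enough in characteristic 0. *)

Lemma count_codom (X : finType) (Z : eqType) (u : X -> Z) z :
  count_mem z (codom u) = #|[pred x | u x == z]|.
Proof. by rewrite count_map cardE -size_filter enumT /enum_mem -enumT. Qed.

Lemma perm_of_fibers (X : finType) (Z : eqType) (u v : X -> Z) :
    (forall z, #|[pred x | u x == z]| = #|[pred x | v x == z]|) ->
  exists tau : {perm X}, forall x, u (tau x) = v x.
Proof.
move=> cuv.
have /tuple_permP [p Hp] : perm_eq (codom_tuple v) (codom_tuple u).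
  by apply/allP => z _ /=; rewrite !count_codom cuv.
have inj : injective (fun x => enum_val (p (enum_rank x))).
  by move=> x y /enum_val_inj /perm_inj /enum_rank_inj.
exists (perm inj) => x; rewrite permE -[RHS]/(v x) -{2}(enum_rankK x).
have e := congr1 (fun s => nth (u x) s (enum_rank x)) Hp.
move: e; rewrite /= nth_codom => ->.
by rewrite (nth_map (enum_rank x)) ?size_enum_ord ?ltn_ord // nth_ord_enum
           (tnth_nth (u x)) nth_codom.
Qed.

(** Halmos-Vaughan induction on [#|A|]. If some nonempty proper part [S] has exactly [#|S|]
    neighbours, [S] and [A :\: S] are matched separately, the latter outside the neighbours of [S].
    Otherwise every such part has a neighbour to spare, and one edge can be removed. *)
Lemma hall (T : finType) (A : {set T}) (e : T -> T -> bool) :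
    (forall S : {set T}, S \subset A ->
       #|S| <= #|[set y | [exists x in S, e x y]]|)%N ->
  exists f : T -> T,
    {in A &, injective f} /\ {in A, forall x, e x (f x)}.
Proof.
pose nb (e : T -> T -> bool) (S : {set T}) := [set y | [exists x in S, e x y]].
have [m] := ubnP #|A|; elim: m A e => // m IH A e /ltnSE leAm hallA.
have nbU f S S' : nb f (S :|: S') = nb f S :|: nb f S'.
  apply/setP => y; rewrite !inE; apply/existsP/orP.
    case=> x /andP[/setUP [xS|xS] exy]; [left|right];
      by apply/existsP; exists x; rewrite xS.
  by case=> /existsP [x /andP [xS exy]]; exists x; rewrite !inE xS ?orbT.
have [->|/set0Pn [x xA]] := eqVneq A set0.
  by exists id; split => x; rewrite inE.
have [/existsP [S /and3P [SA S0 /eqP eS]]|noS] :=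
  boolP [exists S : {set T}, [&& S \proper A, S != set0 & #|nb e S| == #|S|]].
  have [ltSA sSA] := (proper_card SA, proper_sub SA).
  have [f [finj fe]] : exists f : T -> T,
      {in S &, injective f} /\ {in S, forall x, e x (f x)}.
    apply: IH; first by apply: leq_trans leAm.
    by move=> S' sS'; apply: hallA; apply: subset_trans sS' sSA.
  pose e' z y := e z y && (y \notin nb e S).
  have [g [ginj ge]] : exists g : T -> T,
      {in A :\: S &, injective g} /\ {in A :\: S, forall x, e' x (g x)}.
    apply: IH.
      apply: leq_trans leAm; rewrite cardsD (setIidPr sSA).
      by have := S0; rewrite -card_gt0; have := ltSA; lia.
    move=> S' sS'.
    have sS'A : S' \subset A by apply: subset_trans sS' (subsetDl _ _).
    (* Hall's condition for [S :|: S'], minus the [#|S|] neighbours of [S], is the condition for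
       [S'] in the reduced relation [e']. *)
    have := hallA (S :|: S'); rewrite subUset sSA sS'A => /(_ isT).
    rewrite -/(nb e _) -/(nb e' _) nbU.
    have -> : nb e S :|: nb e S' = nb e S :|: nb e' S'.
      apply/setP => y; rewrite !inE.
      case: (boolP [exists x in S, e x y]) => //= nS.
      apply: eq_existsb => z; rewrite /e' inE (negbTE nS) /=.
      by rewrite andbT.
    have dSS' : S :&: S' = set0.
      apply/setP => z; rewrite !inE; apply/negP => /andP [zS zS'].
      by have /setDP [_ /negP] := fintype.subsetP sS' _ zS'.
    by rewrite cardsU dSS' cards0 subn0 => /leq_trans /(_ (leq_card_setU _ _)); lia.
  exists (fun z => if z \in S then f z else g z); split=> [z z' zA z'A|z zA].
    have nbf u : u \in S -> f u \in nb e S.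
      by move=> uS; rewrite inE; apply/existsP; exists u; rewrite uS fe.
    have nbg u : u \in A -> u \notin S -> g u \notin nb e S.
      by move=> uA uS; have /andP [] : e' u (g u) by apply: ge; rewrite inE uS.
    case: ifPn => zS; case: ifPn => z'S.
    - exact: finj.
    - by move=> E; have := nbg _ z'A z'S; rewrite -E nbf.
    - by move=> E; have := nbg _ zA zS; rewrite E nbf.
    - by apply: ginj; rewrite inE ?zS ?z'S.
  case: ifPn => zS; first exact: fe.
  by have /andP [] : e' z (g z) by apply: ge; rewrite inE zS.
have /card_gt0P [y] : (0 < #|nb e [set x]|)%N.
  by apply: leq_trans (hallA [set x] _); rewrite ?cards1 ?sub1set.
rewrite inE => /existsP [x'] /andP [/set1P -> exy].
pose e' z w := e z w && (w != y).
have [g [ginj ge]] : exists g : T -> T,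
    {in A :\ x &, injective g} /\ {in A :\ x, forall x, e' x (g x)}.
  apply: IH.
    by apply: leq_trans leAm; rewrite [X in (_ < X)%N](cardsD1 x) xA.
  move=> S sS; have [->|S0] := eqVneq S set0; first by rewrite cards0.
  have pSA : S \proper A.
    by apply: sub_proper_trans sS _; apply: properD1.
  have := hallA S (proper_sub pSA); rewrite -/(nb e S) -/(nb e' S).
  have neq : #|nb e S| != #|S|.
    by apply: contra noS => E; apply/existsP; exists S; rewrite pSA S0.
  have sub : nb e S \subset y |: nb e' S.
    apply/fintype.subsetP => w; rewrite !inE => /existsP [z /andP [zS ezw]].
    case: eqVneq => //= wy; apply/existsP; exists z.
    by rewrite zS /e' ezw wy.
  have := subset_leq_card sub; rewrite cardsU1; move/eqP: neq.
  by case: (y \notin _); lia.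
exists (fun z => if z == x then y else g z); split=> [z z' zA z'A|z zA].
  have gy u : u \in A -> u != x -> g u != y.
    by move=> uA ux; have /andP [] : e' u (g u) by apply: ge; rewrite !inE ux.
  case: eqVneq => [->|zx]; case: eqVneq => [->|z'x] //.
  - by move=> E; have := gy _ z'A z'x; rewrite -E eqxx.
  - by move=> E; have := gy _ zA zx; rewrite E eqxx.
  - by apply: ginj; rewrite !inE ?zx ?z'x.
case: eqVneq => [->//|zx].
by have /andP [] : e' z (g z) by apply: ge; rewrite !inE zx.
Qed.

(** [sigma] is a [#|J|]-regular bipartite multigraph between two copies of [I]. The edges leaving a
    set [S] of blocks end in distinct points of its neighbourhood times [J], and this count is
    Hall's condition. *)
Lemma block_perfect_matching (I J : finType) (j0 : J) (sigma : {perm I * J}) :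
  exists mu : {perm I}, forall i, exists j, (sigma (i, j)).1 = mu i.
Proof.
pose e i i' := [exists j, (sigma (i, j)).1 == i'].
have J_gt0 : (0 < #|J|)%N by apply/card_gt0P; exists j0.
have [S _|f [finj fe]] := @hall I setT e.
  set N := [set y | _]; rewrite -(leq_pmul2r J_gt0) -!cardsT -!cardsX.
  rewrite -(card_imset _ (@perm_inj _ sigma)); apply/subset_leq_card.
  apply/fintype.subsetP => _ /imsetP [[i j] /setXP [iS _] ->].
  rewrite inE /= in_setT andbT inE; apply/existsP; exists i; rewrite iS /=.
  by apply/existsP; exists j.
have finj' : injective f by move=> x y; apply: finj; rewrite inE.
exists (perm finj') => i; have /existsP [j /eqP] := fe i (in_setT _).
by exists j; rewrite permE.
Qed.

End Permutations.

(** * Brackets and Kempe reduction *)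

Section Pairings.
Variable K : numFieldType.

(** The bracket of two standard basis vectors, i.e. the alternating form in coordinates. *)
Definition eps (i j : 'I_2) : K := (j : nat)%:R - (i : nat)%:R.

Definition wt (X : finType) (s : {ffun X -> 'I_2}) : nat := \sum_x s x.

Lemma ord2E (i : 'I_2) : i = ix \/ i = iy.
Proof. by case: i => [[|[|]]] // p; [left | right]; apply: val_inj. Qed.

Lemma big_ord2 (V : nmodType) (F : 'I_2 -> V) : \sum_i F i = F ix + F iy.
Proof. by rewrite !big_ord_recl big_ord0 addr0; congr (_ + F _); apply: val_inj. Qed.

Lemma big_prod2 (F : 'I_2 -> K) : \prod_i F i = F ix * F iy.
Proof. by rewrite !big_ord_recl big_ord0 mulr1; congr (_ * F _); apply: val_inj. Qed.

Lemma eps_neq0 i j : eps i j != 0 -> (i + j = 1)%N.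
Proof.
by case: (ord2E i) => ->; case: (ord2E j) => ->; rewrite /eps /= ?subrr ?eqxx.
Qed.

Lemma big_eps_neq0 (X : finType) (u v : X -> 'I_2) :
  \prod_x eps (u x) (v x) != 0 -> (\sum_x u x + \sum_x v x = #|X|)%N.
Proof.
move=> /prodf_neq0 nz; rewrite -big_split -sum1_card /=.
by apply: eq_bigr => x _; apply: eps_neq0; apply: nz.
Qed.

Lemma wt_card (X : finType) (s : {ffun X -> 'I_2}) : wt s = #|[pred x | s x == iy]|.
Proof.
rewrite -sum1_card /wt [RHS]big_mkcond /=; apply: eq_bigr => x _.
by rewrite inE; case: (ord2E (s x)) => ->.
Qed.

Lemma wt_le (X : finType) (s : {ffun X -> 'I_2}) : (wt s <= #|X|)%N.
Proof. by rewrite wt_card max_card. Qed.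

Lemma card_wt (X : finType) k :
  #|[pred s : {ffun X -> 'I_2} | wt s == k]| = 'C(#|X|, k).
Proof.
rewrite -card_draws.
pose F (s : {ffun X -> 'I_2}) : {set X} := [set x | s x == iy].
have Finj : injective F.
  move=> s t /setP E; apply/ffunP => x; have := E x; rewrite !inE.
  by case: (ord2E (s x)) => ->; case: (ord2E (t x)) => ->.
rewrite -(card_image Finj); apply: eq_card => A.
apply/imageP/idP => [[s /eqP <- ->]|]; rewrite inE.
  by rewrite /F wt_card cardsE.
move=> /eqP cA; exists [ffun x => if x \in A then iy else ix].
  rewrite inE wt_card -cA; apply/eqP; apply: eq_card => x.
  by rewrite !inE ffunE; case: ifP.
by apply/setP => x; rewrite inE ffunE; case: ifP.
Qed.

Lemma perm_of_wt (X : finType) (s t : {ffun X -> 'I_2}) :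
  wt s = wt t -> exists tau : {perm X}, forall x, s (tau x) = t x.
Proof.
move=> E; apply: perm_of_fibers => z.
have E1 : #|[pred x | s x == iy]| = #|[pred x | t x == iy]| by rewrite -!wt_card.
case: (ord2E z) => -> //.
have C (u : {ffun X -> 'I_2}) :
    (#|[pred x | u x == iy]| + #|[pred x | u x == ix]| = #|X|)%N.
  rewrite -(cardC [pred x | u x == iy]); congr (_ + _)%N.
  by apply: eq_card => x; rewrite !inE; case: (ord2E (u x)) => ->.
by apply/eqP; rewrite -(eqn_add2l #|[pred x | s x == iy]|) C E1 C.
Qed.

(** The invariant bilinear form on the [#|X|]-th symmetric power, as a symmetrised product of
    brackets. *)
Definition pairing_sum (X : finType) (u v : {ffun X -> 'I_2}) : K :=
  \sum_(rho : {perm X}) \prod_x eps (u x) (v (rho x)).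

(** The sum depends on [v] only through its weight, and vanishes unless the weights are
    complementary. So it is the sum over all [v], to which every [rho] contributes (-1)^(wt u),
    divided by the number of functions of that weight. *)
Lemma pairing_sumE (X : finType) (u v : {ffun X -> 'I_2}) :
  pairing_sum u v = if (wt u + wt v == #|X|)%N then
    (#|X|)`!%:R * (-1) ^+ wt u / 'C(#|X|, wt u)%:R else 0.
Proof.
have vanish v' : (wt u + wt v' != #|X|)%N -> pairing_sum u v' = 0.
  move=> neq; apply: big1 => rho _; apply/eqP; apply: contraNT neq.
  move/big_eps_neq0 <-; apply/eqP; congr (_ + _)%N.
  by rewrite /wt (reindex_inj (@perm_inj _ rho)).
case: ifPn => [/eqP E|neq]; last exact: vanish.
have same v' : wt v' = wt v -> pairing_sum u v' = pairing_sum u v.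
  case/perm_of_wt => tau Htau; rewrite /pairing_sum.
  rewrite [LHS](reindex_inj (mulIg tau)); apply: eq_bigr => rho _.
  by apply: eq_bigr => x _; rewrite permM Htau.
have Cu : 'C(#|X|, wt v) = 'C(#|X|, wt u).
  by rewrite -bin_sub ?wt_le //; congr 'C(_, _); lia.
have total : \sum_v' pairing_sum u v' = (#|X|)`!%:R * (-1) ^+ wt u.
  rewrite exchange_big /= (eq_bigr (fun _ => (-1) ^+ wt u)); last first.
    move=> rho _.
    transitivity (\sum_(v' : {ffun X -> 'I_2}) \prod_x eps (u x) (v' x)).
      have b : bijective (fun v' : {ffun X -> 'I_2} => [ffun x => v' (rho x)]).
        exists (fun v' : {ffun X -> 'I_2} => [ffun x => v' (rho^-1%g x)]) => w;
          by apply/ffunP => x; rewrite !ffunE ?permK ?permKV.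
      rewrite [RHS](reindex _ (onW_bij _ b)); apply: eq_bigr => w _.
      by apply: eq_bigr => x _; rewrite ffunE.
    rewrite -(bigA_distr_bigA (fun x c => eps (u x) c)) /wt expr_sum; apply: eq_bigr => x _.
    by rewrite big_ord2 /eps; case: (ord2E (u x)) => -> /=; ring.
  rewrite sumr_const -[#|X|]cardsT -card_Sym mulr_natl; congr (_ *+ _).
  by apply: eq_card => rho; rewrite !inE; apply/esym/fintype.subsetP.
move: total; rewrite (bigID (fun v' => wt v' == wt v)) /= [X in _ + X]big1 ?addr0.
  rewrite (eq_bigr (fun _ => pairing_sum u v)); last by move=> v' /eqP /same.
  rewrite sumr_const card_wt Cu => <-; rewrite -(mulr_natr (pairing_sum u v)) mulfK //.
  by rewrite pnatr_eq0 -lt0n bin_gt0 wt_le.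
by move=> v' neq; apply: vanish; apply: contra neq; lia.
Qed.

End Pairings.

Section Kempe.
Variables (K : numFieldType) (X : finType).
Implicit Types S : {ffun bool * X -> 'I_2}.

(** The points of [bool * X] are coloured by their first component. [pairing] multiplies brackets
    along an arbitrary perfect matching of them, [bipairing] along one whose edges all join the two
    colours. *)
Definition pairing (tau : {perm bool * X}) S : K :=
  \prod_x eps K (S (tau (true, x))) (S (tau (false, x))).

Definition bipairing (sigma : {perm X}) S : K :=
  \prod_x eps K (S (true, x)) (S (false, sigma x)).

Definition bispan (G : {ffun bool * X -> 'I_2} -> K) :=
  exists lambda : {perm X} -> K,
    forall S, G S = \sum_sigma lambda sigma * bipairing sigma S.

Lemma bispan_sum (I : finType) (c : I -> K) G :
  (forall i, bispan (G i)) -> bispan (fun S => \sum_i c i * G i S).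
Proof.
move=> /choice [lambda Hl]; exists (fun sigma => \sum_i c i * lambda i sigma) => S.
under eq_bigr => i _ do rewrite Hl mulr_sumr.
rewrite exchange_big; apply: eq_bigr => sigma _; rewrite mulr_suml.
by apply: eq_bigr => i _; rewrite mulrA.
Qed.

Lemma bispan_add G G' : bispan G -> bispan G' -> bispan (fun S => G S + G' S).
Proof.
move=> [l Hl] [l' Hl']; exists (fun sigma => l sigma + l' sigma) => S.
by rewrite Hl Hl' -big_split; apply: eq_bigr => sigma _; rewrite mulrDl.
Qed.

(** Orienting each edge from colour true to colour false gives a permutation; every edge that has to
    be turned round costs a sign. *)
Lemma bispan_bicoloured (tau : {perm bool * X}) :
    (forall x, (tau (false, x)).1 = ~~ (tau (true, x)).1) ->
  bispan (pairing tau).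
Proof.
move=> bicol; pose c x := (tau (true, x)).1.
pose a x := (tau (c x, x)).2; pose b x := (tau (~~ c x, x)).2.
have aE x : tau (c x, x) = (true, a x).
  apply/eqP; rewrite -pair_eqE /= eqxx andbT.
  by case E : (c x); rewrite ?bicol; rewrite /c in E; rewrite E.
have bE x : tau (~~ c x, x) = (false, b x).
  apply/eqP; rewrite -pair_eqE /= eqxx andbT.
  by case E : (c x); rewrite ?bicol; rewrite /c in E; rewrite E.
have ainj : injective a.
  by move=> x y E; have := aE x; rewrite E -aE => /perm_inj [].
have binj : injective b.
  by move=> x y E; have := bE x; rewrite E -bE => /perm_inj [].
pose sigma := ((perm ainj)^-1 * perm binj)%g.
exists (fun s => (s == sigma)%:R * \prod_x (-1) ^+ ~~ c x) => S.
rewrite (bigD1 sigma) //= eqxx mul1r [X in _ + X]big1 ?addr0; last first.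
  by move=> s ns; rewrite (negbTE ns) !mul0r.
rewrite /bipairing [X in _ = _ * X](reindex_inj (@perm_inj _ (perm ainj))) -big_split /=.
apply: eq_bigr => x _; rewrite /sigma permM permK !permE -aE -bE.
by case: (c x) => /=; rewrite ?mul1r // expr1 /eps; ring.
Qed.

(* Kempe: a bracket joining two points of one colour forces a bracket joining
   two points of the other one, and the Pluecker relation
   [aa'][bb'] = [ab][a'b'] - [ab'][a'b] makes both bicoloured. *)
Lemma bispan_pairing (tau : {perm bool * X}) : bispan (pairing tau).
Proof.
pose mono (tau : {perm bool * X}) x := (tau (true, x)).1 && (tau (false, x)).1.
have [m] := ubnP #|mono tau|; elim: m tau => // m IH tau /ltnSE le_m.
have sum_col : (\sum_x ((tau (true, x)).1 + (tau (false, x)).1) = \sum_(x : X) 1)%N.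
  transitivity (\sum_(p : bool * X) (tau p).1)%N.
    rewrite big_split /= (eq_bigr (fun p => nat_of_bool (tau (p.1, p.2)).1)); last by case.
    by rewrite -(pair_bigA _ (fun b x => nat_of_bool (tau (b, x)).1)) big_bool.
  transitivity (\sum_(p : bool * X) p.1)%N.
    by rewrite [RHS](reindex_perm tau).
  by rewrite -(pair_bigA _ (fun b (x : X) => nat_of_bool b)) big_bool /= big1_eq addn0.
have [/existsP [x0 mx0]|] := boolP [exists x, mono tau x]; last first.
  move=> /existsPn nomono; apply: bispan_bicoloured => x.
  have le1 y : ((tau (true, y)).1 + (tau (false, y)).1 <= 1)%N.
    by have := nomono y; rewrite /mono; case: (_.1); case: (_.1).
  have /eqP := sum_col; rewrite eqn_leq => /andP [_].
  rewrite (bigD1 x) //= [leqRHS](bigD1 x) //=.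
  have : (\sum_(i | i != x) ((tau (true, i)).1 + (tau (false, i)).1) <=
     \sum_(i | i != x) 1)%N by apply: leq_sum.
  by have := le1 x; case: (_.1); case: (_.1) => //=; lia.
have [x1 /andP [nx1 nx1']] : exists x, ~~ (tau (true, x)).1 && ~~ (tau (false, x)).1.
  apply/existsP; rewrite -[[exists x, _]]negbK negb_exists; apply/negP => /forallP H.
  have ge1 y : (1 <= (tau (true, y)).1 + (tau (false, y)).1)%N.
    by have := H y; case: (_.1); case: (_.1).
  move: sum_col; rewrite (bigD1 x0) //= [RHS](bigD1 x0) //=.
  have : (\sum_(i | i != x0) 1 <=
     \sum_(i | i != x0) ((tau (true, i)).1 + (tau (false, i)).1))%N by apply: leq_sum.
  by move: mx0 => /andP [-> ->] /=; lia.
have x10 : x1 != x0 by apply: contraNneq nx1 => ->; case/andP: mx0.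
(* With a, a' the endpoints of edge [x0] and b, b' those of [x1], [t1] gives [ab][a'b'] and [t2]
   gives [ab'][ba']; the reversed last bracket absorbs the minus sign of the relation. *)
pose t1 := (tperm (false, x0) (true, x1) * tau)%g.
pose t2 := (tperm (false, x0) (false, x1) * tau)%g.
have t1E b x : t1 (b, x) = if (b, x) == (false, x0) then tau (true, x1) else
   if (b, x) == (true, x1) then tau (false, x0) else tau (b, x).
  rewrite permM; case: tpermP => [->|->|]; rewrite ?eqxx //.
  by move=> /eqP /negbTE -> /eqP /negbTE ->.
have t2E b x : t2 (b, x) = if (b, x) == (false, x0) then tau (false, x1) else
   if (b, x) == (false, x1) then tau (false, x0) else tau (b, x).
  rewrite permM; case: tpermP => [->|->|]; rewrite ?eqxx //.
    by case: eqP => [[->]|].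
  by move=> /eqP /negbTE -> /eqP /negbTE ->.
have fewer t : (forall x, x != x0 -> mono t x -> mono tau x) -> ~~ mono t x0 ->
    (#|mono t| < m)%N.
  move=> sub n0; apply: leq_trans le_m; apply: proper_card.
  apply/fintype.properP; split; last by exists x0.
  apply/fintype.subsetP => x; rewrite -!topredE /= => mt.
  by apply: sub => //; apply: contraTneq mt => ->.
have x01 : (x0 == x1) = false by rewrite eq_sym (negbTE x10).
have [[l1 H1] [l2 H2]] : bispan (pairing t1) /\ bispan (pairing t2).
  split; apply: IH; apply: fewer => [x nx|]; rewrite /mono ?t1E ?t2E -!pair_eqE /=.
  - rewrite (negbTE nx); case: eqP => [->|//].
    by rewrite (negbTE nx1') andbF.
  - by rewrite eqxx (negbTE nx1) andbF.
  - rewrite (negbTE nx); case: eqP => [->|//].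
    by rewrite (negbTE nx1).
  - by rewrite eqxx (negbTE nx1') andbF.
have := bispan_add (ex_intro _ l1 H1) (ex_intro _ l2 H2).
case=> l Hl; exists l => S; rewrite -Hl /pairing.
rewrite (bigD1 x0) //= (bigD1 x1) //= [in RHS](bigD1 x0) //= [in RHS](bigD1 x1) //=.
rewrite [X in _ = _ + X](bigD1 x0) //= [X in _ = _ + _ * X](bigD1 x1) //=.
rewrite !t1E !t2E -!pair_eqE /= !eqxx ?x01 ?(negbTE x10) /=.
set r := \prod_(i | _) _.
have r1 : \prod_(i | (i != x0) && (i != x1)) eps K (S (t1 (true, i))) (S (t1 (false, i))) = r.
  apply: eq_bigr => x /andP [/negbTE n0 /negbTE n1].
  by rewrite !t1E -!pair_eqE /= n0 n1.
have r2 : \prod_(i | (i != x0) && (i != x1)) eps K (S (t2 (true, i))) (S (t2 (false, i))) = r.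
  apply: eq_bigr => x /andP [/negbTE n0 /negbTE n1].
  by rewrite !t2E -!pair_eqE /= n0 n1.
by rewrite r1 r2 /eps; ring.
Qed.

End Kempe.

(** * Contraction of bracket monomials along a perfect matching *)

Section Contraction.
Variable K : numFieldType.

Lemma big_ffun_glue (X Y Z C : finType) (p : X -> Y + Z) (g : Y + Z -> X)
    (F : {ffun X -> C} -> K) : cancel p g -> cancel g p ->
  \sum_S F S = \sum_(s : {ffun Y -> C}) \sum_(t : {ffun Z -> C})
    F [ffun x => match p x with inl y => s y | inr z => t z end].
Proof.
move=> pK gK; rewrite pair_bigA /=.
pose h (st : {ffun Y -> C} * {ffun Z -> C}) : {ffun X -> C} :=
  [ffun x => match p x with inl y => st.1 y | inr z => st.2 z end].
have hb : bijective h.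
  exists (fun S : {ffun X -> C} => ([ffun y => S (g (inl y))], [ffun z => S (g (inr z))])).
    move=> [s t]; congr (_, _); apply/ffunP => y; by rewrite !ffunE gK.
  by move=> S; apply/ffunP => x; rewrite !ffunE; case E : (p x) => [y|z];
    rewrite ffunE -E pK.
by rewrite (reindex h (onW_bij _ hb)); apply: eq_bigr.
Qed.

Lemma big_ffun_perm (X C : finType) (tau : {perm X}) (F : {ffun X -> C} -> K) :
  \sum_s F s = \sum_(s : {ffun X -> C}) F [ffun x => s (tau x)].
Proof.
have b : bijective (fun s : {ffun X -> C} => [ffun x => s (tau x)]).
  exists (fun s : {ffun X -> C} => [ffun x => s (tau^-1%g x)]) => s;
    by apply/ffunP => x; rewrite !ffunE ?permK ?permKV.
exact: (reindex _ (onW_bij _ b)).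
Qed.

Variable I : finType.

Definition bw (J : finType) (s : {ffun I * J -> 'I_2}) i : nat :=
  \sum_j s (i, j).

(** The bipartite bracket monomial of [sigma], evaluated on [#|I|] copies of a tensor [D] with two
    groups of [#|J|] symmetric indices: position [a] of the first groups is joined to [sigma a] of
    the second ones. *)
Definition contract (J : finType) (sigma : {perm I * J}) (D : nat -> nat -> K) : K :=
  \sum_(s : {ffun I * J -> 'I_2}) \sum_(t : {ffun I * J -> 'I_2})
    (\prod_a eps K (s a) (t (sigma a))) * \prod_i D (bw s i) (bw t i).

(* If f = sum_k C(n, k) phi_k x^(n-k) y^k, these are, up to nonzero factors
   depending only on n, k and l, the coefficients of f_x /\ f_y. *)
Definition wedge (phi : nat -> K) k l := phi k * phi l.+1 - phi k.+1 * phi l.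

Lemma contract_bipairing (J : finType) (sigma : {perm I * J}) phi :
  \sum_S bipairing K sigma S * \prod_b \prod_i phi (\sum_j S (b, (i, j)))%N =
  contract sigma (fun k l => phi k * phi l).
Proof.
pose p (x : bool * (I * J)) := if x.1 then inl x.2 else inr x.2.
pose g (y : (I * J) + (I * J)) := match y with inl y => (true, y) | inr z => (false, z) end.
rewrite (@big_ffun_glue _ _ _ _ p g) ?/contract; last 2 first.
- by case=> [[] x].
- by case.
apply: eq_bigr => s _; apply: eq_bigr => t _; congr (_ * _).
  by apply: eq_bigr => x _; rewrite !ffunE.
rewrite big_bool /= -big_split /=; apply: eq_bigr => i _.
by rewrite /bw; congr (phi _ * phi _); apply: eq_bigr => j _; rewrite ffunE.
Qed.

(* Hall's theorem matches the points of the two colours block by block; the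
   matched points can be moved to position j0 of their blocks. *)
Lemma contract_relabel (J : finType) (j0 : J) (sigma : {perm I * J}) :
  exists2 sigma' : {perm I * J}, forall i, sigma' (i, j0) = (i, j0) &
    forall phi, contract sigma (fun k l => phi k * phi l) =
                contract sigma' (fun k l => phi k * phi l).
Proof.
have [mu /choice [j Hj]] := block_perfect_matching j0 sigma.
pose j' i := (sigma (i, j i)).2.
have inj1 : injective (fun x : I * J => (x.1, tperm j0 (j x.1) x.2)).
  by move=> [a b] [a' b'] /= [<-] /perm_inj ->.
have inj2 : injective (fun x : I * J => (mu x.1, tperm j0 (j' x.1) x.2)).
  by move=> [a b] [a' b'] /= [/perm_inj <-] /perm_inj ->.
pose tau := perm inj1; pose tau' := perm inj2.
have tauE i k : tau (i, k) = (i, tperm j0 (j i) k) by rewrite permE.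
have tau'E i k : tau' (i, k) = (mu i, tperm j0 (j' i) k) by rewrite permE.
exists (tau * sigma * tau'^-1)%g => [i|phi].
  rewrite !permM tauE tpermL; apply: (canLR (permK _)).
  by rewrite tau'E tpermL -Hj /j'; case: (sigma _).
rewrite /contract (big_ffun_perm tau^-1); apply: eq_bigr => s _.
rewrite (big_ffun_perm tau'^-1); apply: eq_bigr => t _; congr (_ * _).
  rewrite (reindex_perm tau); apply: eq_bigr => a _.
  by rewrite !ffunE permK !permM.
have E1 i : bw [ffun x => s (tau^-1%g x)] i = bw s i.
  rewrite /bw [LHS](reindex_perm (tperm j0 (j i))); apply: eq_bigr => a _.
  rewrite ffunE; congr (nat_of_ord (s _)); apply: (canLR (permK _)).
  by rewrite tauE.
have E2 i : bw [ffun x => t (tau'^-1%g x)] (mu i) = bw t i.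
  rewrite /bw [LHS](reindex_perm (tperm j0 (j' i))); apply: eq_bigr => a _.
  rewrite ffunE; congr (nat_of_ord (t _)); apply: (canLR (permK _)).
  by rewrite tau'E.
(* [D] is a product here, so the factors of [s] and [t] separate and the blocks of [t] can be
   renumbered by [mu] on their own. *)
rewrite !big_split /=; congr (_ * _); first by apply: eq_bigr => i _; rewrite E1.
by rewrite (reindex_perm mu); apply: eq_bigr => i _; rewrite E2.
Qed.

(** The brackets at position [ord0] involve no other index and can be summed out block by block: the
    sum of eps b c phi(b + k) phi(c + l) over b and c is [wedge phi k l]. *)
Lemma contract_fixed n (sigma : {perm I * 'I_n.+1}) :
    (forall i, sigma (i, ord0) = (i, ord0)) ->
  exists sigma' : {perm I * 'I_n},
    forall phi, contract sigma (fun k l => phi k * phi l) = contract sigma' (wedge phi).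
Proof.
move=> fix0.
(* [sigma] on the remaining positions. The default [x.2] is never taken, since the positions [ord0]
   are already hit by themselves. *)
pose f (x : I * 'I_n) := let y := sigma (x.1, lift ord0 x.2) in
  (y.1, odflt x.2 (unlift ord0 y.2)).
have fE x : sigma (x.1, lift ord0 x.2) = ((f x).1, lift ord0 (f x).2).
  rewrite /f /=; case E : (sigma _) => [i j] /=; case: unliftP => [j' ->//|j0].
  have /perm_inj [] : sigma (x.1, lift ord0 x.2) = sigma (i, ord0).
    by rewrite fix0 E j0.
  by [].
have finj : injective f.
  move=> x y E; have : sigma (x.1, lift ord0 x.2) = sigma (y.1, lift ord0 y.2).
    by rewrite !fE E.
  move/perm_inj => E'; case: x y {E} E' => [i j] [i' j'] /= E'.
  by congr (_, _); [exact: (congr1 fst E') | apply: lift_inj (congr1 snd E')].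
exists (perm finj) => phi.
pose p (x : I * 'I_n.+1) : I + I * 'I_n :=
  if unlift ord0 x.2 is Some j then inr (x.1, j) else inl x.1.
pose g (y : I + I * 'I_n) :=
  match y with inl i => (i, ord0) | inr z => (z.1, lift ord0 z.2) end.
have pK : cancel p g.
  by case=> [i j]; rewrite /p /=; case: unliftP => [j'|] -> /=.
have gK : cancel g p.
  by case=> [i|[i j]]; rewrite /p /= ?unlift_none ?liftK.
rewrite /contract.
rewrite (big_ffun_glue _ pK gK) exchange_big; apply: eq_bigr => s' _ /=.
under eq_bigr => s0 _ do rewrite (big_ffun_glue _ pK gK) exchange_big.
rewrite exchange_big; apply: eq_bigr => t' _ /=.
set glue := fun (s0 : {ffun I -> 'I_2}) s =>
  [ffun x => match p x with inl y => s0 y | inr z => s z end].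
have glue0 s0 (s : {ffun I * 'I_n -> 'I_2}) i : glue s0 s (i, ord0) = s0 i.
  by rewrite ffunE /p /= unlift_none.
have glueS s0 (s : {ffun I * 'I_n -> 'I_2}) i j : glue s0 s (i, lift ord0 j) = s (i, j).
  by rewrite ffunE /p /= liftK.
have bwg s0 (s : {ffun I * 'I_n -> 'I_2}) i : bw (glue s0 s) i = (s0 i + bw s i)%N.
  rewrite /bw big_ord_recl glue0; congr (_ + _)%N.
  by apply: eq_bigr => j _; rewrite glueS.
transitivity (\sum_(s0 : {ffun I -> 'I_2}) \sum_(t0 : {ffun I -> 'I_2})
   (\prod_a eps K (s' a) (t' (perm finj a))) *
   \prod_i (eps K (s0 i) (t0 i) * (phi (s0 i + bw s' i)%N * phi (t0 i + bw t' i)%N))).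
  apply: eq_bigr => s0 _; apply: eq_bigr => t0 _.
  rewrite [X in _ = _ * X]big_split mulrA; congr (_ * _); last first.
    by apply: eq_bigr => i _; rewrite -/(glue s0 s') -/(glue t0 t') !bwg.
  rewrite (eq_bigr (fun x => eps K (glue s0 s' (x.1, x.2))
     (glue t0 t' (sigma (x.1, x.2))))); last by case.
  rewrite -(pair_bigA _ (fun i j => eps K (glue s0 s' (i, j)) (glue t0 t' (sigma (i, j))))) /=.
  rewrite (eq_bigr (fun i => eps K (s0 i) (t0 i) *
     \prod_j eps K (s' (i, j)) (t' (perm finj (i, j))))); last first.
    move=> i _; rewrite big_ord_recl fix0 !glue0; congr (_ * _).
    apply: eq_bigr => j _; rewrite glueS (fE (i, j)) glueS permE.
    by case: (f _).
  rewrite big_split mulrC /= (pair_bigA _ (fun i j => eps K (s' (i, j)) (t' (perm finj (i, j))))).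
  by congr (_ * _); apply: eq_bigr; case.
transitivity ((\prod_a eps K (s' a) (t' (perm finj a))) *
    \sum_(s0 : {ffun I -> 'I_2}) \sum_(t0 : {ffun I -> 'I_2})
      \prod_i (eps K (s0 i) (t0 i) * (phi (s0 i + bw s' i)%N * phi (t0 i + bw t' i)%N))).
  by rewrite mulr_sumr; apply: eq_bigr => s0 _; rewrite mulr_sumr.
congr (_ * _).
transitivity (\sum_(s0 : {ffun I -> 'I_2}) \prod_i \sum_(b : 'I_2) (eps K (s0 i) b *
   (phi (s0 i + bw s' i)%N * phi (b + bw t' i)%N))).
  apply: eq_bigr => s0 _.
  by rewrite (bigA_distr_bigA (fun i b => eps K (s0 i) b *
    (phi (s0 i + bw s' i)%N * phi ((b : 'I_2) + bw t' i)%N))).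
rewrite -(bigA_distr_bigA (fun i (a : 'I_2) => \sum_(b : 'I_2) (eps K a b *
   (phi (a + bw s' i)%N * phi (b + bw t' i)%N)))).
apply: eq_bigr => i _; rewrite !big_ord2 /eps /wedge /= !add0n !add1n; ring.
Qed.

Lemma contract_bipairing_wedge n (sigma : {perm I * 'I_n.+1}) :
  exists sigma' : {perm I * 'I_n}, forall phi,
    \sum_S bipairing K sigma S * \prod_b \prod_i phi (\sum_j S (b, (i, j)))%N =
    contract sigma' (wedge phi).
Proof.
have [tau fix0 E] := contract_relabel ord0 sigma.
have [sigma' E'] := contract_fixed fix0.
by exists sigma' => phi; rewrite contract_bipairing E E'.
Qed.

End Contraction.

(** * The first fundamental theorem *)

Section Apolar.
Variable K : numFieldType.

Lemma prod_wt (R : comPzRingType) (X : finType) (u : {ffun X -> 'I_2}) (h : 'I_2 -> R) :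
  \prod_x h (u x) = h ix ^+ (#|X| - wt u) * h iy ^+ wt u.
Proof.
rewrite wt_card (bigID (fun x => u x == iy)) /= mulrC; congr (_ * _).
  have -> : (#|X| - #|[pred x | u x == iy]|)%N = #|[predC [pred x | u x == iy]]|.
    by rewrite -(cardC [pred x | u x == iy]) addKn.
  rewrite -prodr_const; apply: eq_big => [x|x]; rewrite ?inE //.
  by case: (ord2E (u x)) => ->.
by rewrite -prodr_const; apply: eq_big => [x|x /eqP ->]; rewrite ?inE.
Qed.

Definition gidx (i j : 'I_2) : 'I_(2 * 2) := mxvec_index i j.

Lemma gidx_inj i j i' j' : gidx i j = gidx i' j' -> (i, j) = (i', j').
Proof.
move=> E; have H a b : (a, b) = mxvec (\matrix_(a, b) (a, b)) 0 (gidx a b).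
  by rewrite mxvecE mxE.
by rewrite H E -H.
Qed.

Lemma gidx_eq i j i' j' : (gidx i j == gidx i' j') = (i == i') && (j == j').
Proof.
apply/eqP/andP => [/gidx_inj [-> ->] //|[/eqP -> /eqP -> //]].
Qed.

Definition gen i j : {mpoly K[2 * 2]} := 'X_(gidx i j).

Definition gmon a b c e : 'X_{1.. 2 * 2} :=
  (U_(gidx ix ix) *+ a + U_(gidx ix iy) *+ b +
   (U_(gidx iy ix) *+ c + U_(gidx iy iy) *+ e))%MM.

Lemma gmonE a b c e i j : gmon a b c e (gidx i j) =
  if i == ix then if j == ix then a else b else if j == ix then c else e.
Proof.
rewrite /gmon !mnmDE !mulmnE !mnm1E !gidx_eq.
by case: (ord2E i) => ->; case: (ord2E j) => ->; rewrite !eqxx /=; lia.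
Qed.

Lemma gmon_eq a b c e a' b' c' e' : (gmon a b c e == gmon a' b' c' e') =
  [&& a == a', b == b', c == c' & e == e'].
Proof.
apply/eqP/and4P => [E|[/eqP -> /eqP -> /eqP -> /eqP ->] //].
have H i j : gmon a b c e (gidx i j) = gmon a' b' c' e' (gidx i j) by rewrite E.
have := (H ix ix, H ix iy, H iy ix, H iy iy); rewrite !gmonE /=.
by case=> [[[-> ->] ->] ->].
Qed.

Lemma gen_prodE a b c e :
  gen ix ix ^+ a * gen ix iy ^+ b * (gen iy ix ^+ c * gen iy iy ^+ e) =
  'X_[gmon a b c e].
Proof. by rewrite /gen !mpolyXn -!mpolyXD. Qed.

(* The SL_2-invariant pairing of binary forms of degree w, seen as a linear
   functional on the forms of bidegree (w, w) in the two rows of a matrix. *)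
Definition apolar w (Q : {mpoly K[2 * 2]}) : K :=
  \sum_(i < w.+1) (-1) ^+ i / 'C(w, i)%:R * Q@_(gmon (w - i) i i (w - i)).

Lemma apolar_sum w (J : Type) (s : seq J) (c : J -> K) (Q : J -> {mpoly K[2 * 2]}) :
  apolar w (\sum_(j <- s) c j *: Q j) = \sum_(j <- s) c j * apolar w (Q j).
Proof.
under [RHS]eq_bigr => j _ do rewrite mulr_sumr.
rewrite exchange_big /=; apply: eq_bigr => i _.
rewrite raddf_sum /= mulr_sumr; apply: eq_bigr => j _.
by rewrite mcoeffZ mulrCA.
Qed.

Lemma apolarX w k l : (k <= w)%N -> (l <= w)%N ->
  apolar w 'X_[gmon (w - k) k (w - l) l] =
  if (k + l == w)%N then (-1) ^+ k / 'C(w, k)%:R else 0.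
Proof.
move=> kw lw; have kw' : (k < w.+1)%N by [].
rewrite /apolar (bigD1 (Ordinal kw')) //= big1 ?addr0 => [|i].
  rewrite mcoeffX gmon_eq !eqxx /=.
  have -> : ((w - l == k) && (l == w - k))%N = (k + l == w)%N by apply/idP/idP; lia.
  by case: (_ == _); rewrite ?mulr1 ?mulr0.
rewrite -val_eqE /= mcoeffX gmon_eq => /negbTE; rewrite eq_sym => ->.
by rewrite andbF mulr0.
Qed.

(** The i-th term of the binomial expansion pairs to (-1)^i C(w, i) (-1)^i / C(w, i) = 1. As the
    total is nonzero, [apolar] recovers c from c det^w. *)
Lemma apolar_det w :
  apolar w ((gen ix ix * gen iy iy - gen ix iy * gen iy ix) ^+ w) = w.+1%:R.
Proof.
rewrite exprBn (eq_bigr (fun i : 'I_w.+1 => ((-1) ^+ i * 'C(w, i)%:R) *: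
   'X_[gmon (w - i) i (w - (w - i)) (w - i)] : {mpoly K[2 * 2]})); last first.
  move=> i _; rewrite -gen_prodE subKn -1?ltnS //.
  rewrite !exprMn -scaler_nat -mul_mpolyC -[in RHS]mul_mpolyC !mpolyCM.
  rewrite rmorphXn rmorphN1; ring.
rewrite apolar_sum (eq_bigr (fun=> 1)) ?sumr_const ?card_ord // => i _.
have iw : (i <= w)%N by rewrite -ltnS.
rewrite apolarX ?leq_subr // subnKC // eqxx mulrACA -expr2 sqrr_sign mul1r mulfV //.
by rewrite pnatr_eq0 -lt0n bin_gt0.
Qed.

(** [S] gives the row and [S'] the column of each factor. If both rows occur [#|X|] times, a
    permutation [tau] of the positions separates the two rows, and the pairing becomes an average of
    bracket products. As [tau] ignores the colours, these run along arbitrary matchings, so Kempe's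
    reduction is needed. *)
Lemma apolar_bispan (X : finType) (S : {ffun bool * X -> 'I_2}) :
  bispan (fun S' => apolar #|X| (\prod_a gen (S a) (S' a))).
Proof.
have cA : #|{: bool * X}| = (#|X| + #|X|)%N by rewrite card_prod card_bool mul2n addnn.
have [wS|wS] := eqVneq (wt S) #|X|; last first.
  (* With unequal row degrees every coefficient read by [apolar] is zero. *)
  exists (fun=> 0) => S'; rewrite [RHS]big1; last by move=> s _; rewrite mul0r.
  apply: big1 => i _; have iw : (i <= #|X|)%N by rewrite -ltnS.
  rewrite /gen mprodXE mcoeffX; case: eqP => [E|_]; last by rewrite mulr0.
  case/negP: wS; apply/eqP.
  have := congr1 (fun m : 'X_{1.. _} => m (gidx iy ix) + m (gidx iy iy))%N E.
  rewrite !gmonE /= !mnm_sumE -big_split /= subnKC // => <-.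
  apply: eq_bigr => a _; rewrite !mnm1E !gidx_eq.
  by case: (ord2E (S a)) => ->; case: (ord2E (S' a)) => ->.
pose S0 : {ffun bool * X -> 'I_2} := [ffun a => if a.1 then ix else iy].
have wS0 : wt S0 = #|X|.
  rewrite /wt (eq_bigr (fun a => nat_of_ord (S0 (a.1, a.2)))); last by case.
  rewrite -(pair_bigA _ (fun b x => nat_of_ord (S0 (b, x)))) big_bool /=.
  under eq_bigr => x _ do rewrite ffunE.
  under [X in (_ + X)%N]eq_bigr => x _ do rewrite ffunE.
  by rewrite /= big1_eq sum1_card.
have [tau Htau] := perm_of_wt (etrans wS (esym wS0)).
(* [rho] moves the second endpoints only; summing over it produces [pairing_sum]. *)
pose inj (rho : {perm X}) := fun a : bool * X => if a.1 then a else (false, rho a.2).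
have injP rho : injective (inj rho).
  by move=> [[] x] [[] y] //= [/perm_inj ->].
have [l Hl] := @bispan_sum K X _ (fun=> (#|X|)`!%:R^-1)
  (fun rho => pairing K (perm (injP rho) * tau)%g) (fun rho => bispan_pairing K _).
exists l => S'; rewrite -Hl.
pose u := [ffun x => S' (tau (true, x))]; pose v := [ffun x => S' (tau (false, x))].
have -> : \prod_a gen (S a) (S' a) =
    (\prod_x gen ix (u x)) * \prod_x gen iy (v x).
  rewrite (reindex_perm tau) /=.
  rewrite (eq_bigr (fun a => gen (S0 (a.1, a.2)) (S' (tau (a.1, a.2))))); last first.
    by move=> [b x] _; rewrite Htau.
  rewrite -(pair_bigA _ (fun b x => gen (S0 (b, x)) (S' (tau (b, x))))) big_bool /=.
  by congr (_ * _); apply: eq_bigr => x _; rewrite !ffunE.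
rewrite !prod_wt gen_prodE apolarX ?wt_le // -mulr_sumr.
have -> : \sum_(rho : {perm X}) pairing K (perm (injP rho) * tau)%g S' = pairing_sum K u v.
  apply: eq_bigr => rho _; apply: eq_bigr => x _.
  by rewrite !permM !permE /inj !ffunE.
rewrite pairing_sumE; case: eqP => _; last by rewrite mulr0.
by rewrite -mulrA mulKf // pnatr_eq0 -lt0n fact_gt0.
Qed.

End Apolar.

(** * Invariants as combinations of contractions of f_x /\ f_y *)

Section Brackets.
Variable K : numFieldType.

Lemma multinom_prod k (m : 'X_{1.. k}) (T : finType) : #|T| = mdeg m ->
  exists kappa : T -> 'I_k, forall (R : comPzRingType) (h : 'I_k -> R),
    \prod_i h i ^+ m i = \prod_t h (kappa t).
Proof.
move=> cT; pose s := flatten [seq nseq (m i) i | i <- enum 'I_k].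
have prod_s (R : comPzRingType) (h : 'I_k -> R) :
    \prod_(j <- s) h j = \prod_i h i ^+ m i.
  rewrite big_flatten big_map /= big_enum /=.
  by apply: eq_bigr => i _; rewrite big_nseq iter_mulr_1.
have sz : size s = #|T|.
  rewrite cT mdegE size_flatten /shape -map_comp sumnE big_map big_enum /=.
  by apply: eq_bigr => i _; rewrite /= size_nseq.
pose kappa (t : T) := tnth (in_tuple s) (cast_ord (esym sz) (enum_rank t)).
exists kappa => R h; rewrite -prod_s big_tnth.
rewrite (reindex (fun t : T => cast_ord (esym sz) (enum_rank t))) //.
exists (fun j => enum_val (cast_ord sz j)) => [t _|j _].
  by rewrite cast_ordKV enum_rankK.
by rewrite enum_valK cast_ordK.
Qed.

Lemma big_curry (I J C : finType) (V : comPzRingType)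
    (G : bool -> I -> {ffun J -> C} -> V) :
  \prod_b \prod_i \sum_s G b i s =
  \sum_(S : {ffun bool * (I * J) -> C}) \prod_b \prod_i G b i [ffun j => S (b, (i, j))].
Proof.
rewrite (pair_bigA _ (fun b i => \sum_s G b i s)) /=.
rewrite (bigA_distr_bigA (fun (t : bool * I) s => G t.1 t.2 s)).
pose h (S : {ffun bool * (I * J) -> C}) : {ffun bool * I -> {ffun J -> C}} :=
  [ffun t => [ffun j => S (t.1, (t.2, j))]].
have hb : bijective h.
  exists (fun f : {ffun bool * I -> {ffun J -> C}} => [ffun a => f (a.1, a.2.1) a.2.2]).
    by move=> S; apply/ffunP => -[b [i j]]; rewrite !ffunE.
  by move=> f; apply/ffunP => -[b i]; apply/ffunP => j; rewrite !ffunE.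
rewrite (reindex h (onW_bij _ hb)); apply: eq_bigr => S _.
rewrite (pair_bigA _ (fun b i => G b i [ffun j => S (b, (i, j))])) /=.
by apply: eq_bigr => -[b i] _; rewrite ffunE.
Qed.

(* The coefficients of f(x . M) for a generic matrix M, where
   f = sum_k C(n, k) phi_k x^(n-k) y^k. *)
Definition gen_coef n (phi : nat -> K) k : {mpoly K[2 * 2]} :=
  \sum_(s : {ffun 'I_n -> 'I_2}) \sum_(s' : {ffun 'I_n -> 'I_2})
    ((wt s == k)%:R * phi (wt s')) *: \prod_a gen K (s a) (s' a).

Lemma gen_coef_homog n phi k : gen_coef n phi k \is n.-homog.
Proof.
apply: rpred_sum => s _; apply: rpred_sum => s' _; apply: dhomogZ.
rewrite /gen mprodXE dhomogX /= mdeg_sum.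
by under eq_bigr => i _ do rewrite mdeg1; rewrite sum1_card card_ord.
Qed.

Variables (I : finType) (n : nat).

(** The coefficients [lambda] do not depend on [phi]; this is what later allows the same combination
    to be evaluated on another tensor. *)
Definition contract_span (G : (nat -> K) -> K) :=
  exists lambda : {perm I * 'I_n} -> K,
    forall phi, G phi = \sum_sigma lambda sigma * contract sigma (wedge phi).

Lemma contract_span_sum (J : eqType) (s : seq J) (c : J -> K) G :
  (forall j, j \in s -> contract_span (G j)) ->
  contract_span (fun phi => \sum_(j <- s) c j * G j phi).
Proof.
elim: s => [|j s IH] spanG.
  exists (fun=> 0) => phi; rewrite big_nil big1 // => sigma _; exact: mul0r.
have [i si|l Hl] := IH; first by apply: spanG; rewrite inE si orbT.
have [l' Hl'] := spanG j (mem_head _ _).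
exists (fun sigma => c j * l' sigma + l sigma) => phi.
rewrite big_cons Hl' Hl mulr_sumr -big_split /=.
by apply: eq_bigr => sigma _; rewrite mulrDl mulrA.
Qed.

Lemma contract_span_contract (sigma : {perm I * 'I_n}) :
  contract_span (fun phi => contract sigma (wedge phi)).
Proof.
exists (fun s => (s == sigma)%:R) => phi.
rewrite (bigD1 sigma) //= eqxx mul1r big1 ?addr0 // => s ns.
by rewrite (negbTE ns) mul0r.
Qed.

Local Notation w := #|{: I * 'I_n.+1}|.

(** A monomial of degree 2 [#|I|] takes one coefficient from each of 2 [#|I|] copies of f, labelled
    by [bool * I]. For any other degree the total degree in the matrix entries is not 2w, and
    [apolar] vanishes. *)
Lemma apolar_monomial_span (m : 'X_{1.. n.+2}) :
  contract_span (fun phi => apolar w (\prod_(i < n.+2) gen_coef n.+1 phi i ^+ m i)).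
Proof.
have cw : w = (#|I| * n.+1)%N by rewrite card_prod card_ord.
have [cT|neq] := eqVneq #|{: bool * I}| (mdeg m); last first.
  exists (fun=> 0) => phi; rewrite [RHS]big1; last by move=> sigma _; exact: mul0r.
  have hom : \prod_(i < n.+2) gen_coef n.+1 phi i ^+ m i \is (n.+1 * mdeg m).-homog.
    rewrite mdegE big_distrr /=.
    apply: (big_ind2 (fun (p : {mpoly K[2 * 2]}) k => p \is k.-homog)) => //.
    - exact: dhomog1.
    - by move=> p k q l; apply: dhomogM.
    - by move=> j _; apply/dhomogMn/gen_coef_homog.
  apply: big1 => i _; have iw : (i <= w)%N by rewrite -ltnS.
  rewrite (dhomog_nemf_coeff hom) ?mulr0 //.
  rewrite /gmon /= !mdegD !mdegMn !mdeg1 !mul1n.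
  move: neq; rewrite card_prod card_bool; apply: contra => /eqP.
  rewrite subnK // subnKC // cw => E.
  by rewrite -(eqn_pmul2l (ltn0Sn n)); apply/eqP; move: E; lia.
have [kappa Hk] := multinom_prod cT.
(* [cS] records which coefficients the monomial selects and depends on the row indices alone; [pS]
   carries the coefficients of f and depends on the column indices alone. *)
pose cS (S : {ffun bool * (I * 'I_n.+1) -> 'I_2}) : K :=
  \prod_b \prod_i (wt [ffun j => S (b, (i, j))] == kappa (b, i))%:R.
pose pS (phi : nat -> K) (S : {ffun bool * (I * 'I_n.+1) -> 'I_2}) : K :=
  \prod_b \prod_i phi (wt [ffun j => S (b, (i, j))]).
have expand phi : \prod_(i < n.+2) gen_coef n.+1 phi i ^+ m i =
    \sum_(S : {ffun bool * (I * 'I_n.+1) -> 'I_2})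
    \sum_(S' : {ffun bool * (I * 'I_n.+1) -> 'I_2})
      (cS S * pS phi S') *: \prod_a gen K (S a) (S' a).
  rewrite Hk (eq_bigr (fun t => gen_coef n.+1 phi (kappa (t.1, t.2)))); last by case.
  rewrite -(pair_bigA _ (fun b i => gen_coef n.+1 phi (kappa (b, i)))) /=.
  rewrite (big_curry (fun b i s => \sum_(s' : {ffun 'I_n.+1 -> 'I_2})
    ((wt s == kappa (b, i))%:R * phi (wt s')) *: \prod_a gen K (s a) (s' a))).
  apply: eq_bigr => S _.
  rewrite (big_curry (fun b i s' =>
    ((wt [ffun j => S (b, (i, j))] == kappa (b, i))%:R * phi (wt s')) *:
       \prod_a gen K ([ffun j => S (b, (i, j))] a) (s' a))).
  apply: eq_bigr => S' _.
  under eq_bigr => b _ do rewrite scaler_prod.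
  rewrite scaler_prod; congr (_ *: _).
    under eq_bigr => b _ do rewrite big_split.
    by rewrite big_split.
  rewrite [RHS](eq_bigr (fun a => gen K (S (a.1, (a.2.1, a.2.2)))
     (S' (a.1, (a.2.1, a.2.2))))); last by case=> b [].
  rewrite -(pair_bigA _ (fun b a => gen K (S (b, (a.1, a.2))) (S' (b, (a.1, a.2))))) /=.
  apply: eq_bigr => b _.
  rewrite -(pair_bigA _ (fun i j => gen K (S (b, (i, j))) (S' (b, (i, j))))) /=.
  by apply: eq_bigr => i _; apply: eq_bigr => j _; rewrite !ffunE.
have /choice [l Hl] : forall S : {ffun bool * (I * 'I_n.+1) -> 'I_2},
    exists l : {perm I * 'I_n.+1} -> K,
    forall S' : {ffun bool * (I * 'I_n.+1) -> 'I_2}, apolar w (\prod_a gen K (S a) (S' a)) =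
    \sum_sigma l sigma * bipairing K sigma S' := @apolar_bispan K _.
have /choice [tau Htau] : forall sigma : {perm I * 'I_n.+1},
    exists sigma' : {perm I * 'I_n}, forall phi,
      \sum_S bipairing K sigma S * \prod_b \prod_i phi (\sum_j S (b, (i, j)))%N =
      contract sigma' (wedge phi) := @contract_bipairing_wedge K I n.
have [l' Hl'] := @contract_span_sum _ (index_enum {perm I * 'I_n.+1})
  (fun sigma => \sum_S cS S * l S sigma) _
  (fun sigma _ => contract_span_contract (tau sigma)).
exists l' => phi; rewrite -Hl' expand.
rewrite pair_bigA /= apolar_sum.
rewrite -(pair_bigA _ (fun S S' => cS S * pS phi S' * apolar w (\prod_a gen K (S a) (S' a)))) /=.
rewrite (eq_bigr (fun S => \sum_sigma cS S * l S sigma *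
   contract (tau sigma) (wedge phi))); last first.
  move=> S _; under eq_bigr => S' _ do rewrite Hl mulr_sumr.
  rewrite exchange_big /=; apply: eq_bigr => sigma _.
  rewrite -Htau mulr_sumr; apply: eq_bigr => S' _.
  rewrite mulrACA; congr (_ * _); rewrite mulrC; congr (_ * _).
  apply: eq_bigr => b _; apply: eq_bigr => i _; congr (phi _).
  by apply: eq_bigr => j _; rewrite ffunE.
rewrite exchange_big; apply: eq_bigr => sigma _.
by rewrite mulr_suml.
Qed.

(* First fundamental theorem for SL_2, combined with Kempe's theorem. *)
Lemma apolar_span (P : {mpoly K[n.+2]}) :
  contract_span (fun phi => apolar w
    (mmap (@mpolyC _ _) (fun i : 'I_n.+2 => gen_coef n.+1 phi i) P)).
Proof.
have [l Hl] := @contract_span_sum _ (msupp P) (fun m => P@_m) _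
  (fun m _ => apolar_monomial_span m).
exists l => phi; rewrite -Hl -apolar_sum /mmap; congr (apolar _ _).
by apply: eq_bigr => m _; rewrite mul_mpolyC.
Qed.

End Brackets.

(** * Symmetric powers and binary forms *)

Section SymmetricPowers.
Variable K : numFieldType.
Implicit Types (M : 'M[K]_2) (a : nat -> K).

Lemma poly_eq0_of_values (p : {poly K}) : (forall u, p.[u] = 0) -> p = 0.
Proof.
move=> p0; apply/eqP; apply: contraT => nz.
have := max_poly_roots nz (rs := [seq i%:R | i <- iota 0 (size p)]).
rewrite size_map size_iota ltnn; apply.
  by apply/allP => _ /mapP [i _ ->]; apply/rootP.
by rewrite map_inj_uniq ?iota_uniq // => i j /eqP; rewrite eqr_nat => /eqP.
Qed.

(** The umbral functional X^j |-> a j: on a product of linear forms it performs the multilinear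
    expansion and collects the terms by weight. *)
Definition coef_fun a (p : {poly K}) : K := \sum_(j < size p) p`_j * a j.

Lemma coef_funE a (p : {poly K}) m : (size p <= m)%N -> coef_fun a p = \sum_(j < m) p`_j * a j.
Proof.
move=> le; rewrite /coef_fun (big_ord_widen m (fun j => p`_j * a j) le) big_mkcond /=.
by apply: eq_bigr => j _; case: ltnP => // /(nth_default 0) ->; rewrite mul0r.
Qed.

Lemma coef_funD a p q : coef_fun a (p + q) = coef_fun a p + coef_fun a q.
Proof.
pose m := maxn (size p) (size q).
rewrite !(@coef_funE a _ m) ?leq_maxl ?leq_maxr ?size_polyD // -big_split.
by apply: eq_bigr => j _; rewrite coefD mulrDl.
Qed.

Lemma coef_funZ a c p : coef_fun a (c *: p) = c * coef_fun a p.
Proof.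
rewrite (@coef_funE a _ (size p)) ?size_scale_leq // mulr_sumr.
by apply: eq_bigr => j _; rewrite coefZ mulrA.
Qed.

Lemma coef_funXn a k : coef_fun a 'X^k = a k.
Proof.
rewrite /coef_fun size_polyXn (bigD1 ord_max) //= coefXn eqxx mul1r big1 ?addr0 //.
by move=> i; rewrite -val_eqE /= coefXn => /negbTE ->; rewrite mul0r.
Qed.

Lemma coef_fun_sum a (I : Type) (r : seq I) (c : I -> K) (Q : I -> {poly K}) :
  coef_fun a (\sum_(i <- r) c i *: Q i) = \sum_(i <- r) c i * coef_fun a (Q i).
Proof.
elim: r => [|i r IH]; first by rewrite !big_nil /coef_fun size_poly0 big_ord0.
by rewrite !big_cons coef_funD coef_funZ IH.
Qed.

Definition lin M (i : 'I_2) : {poly K} := (M i ix)%:P + M i iy *: 'X.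

Definition rowp M n k : {poly K} := lin M ix ^+ (n - k) * lin M iy ^+ k.

Lemma coef_linX (c d : K) k j : ((c%:P + d *: 'X) ^+ k)`_j = c ^+ (k - j) * d ^+ j *+ 'C(k, j).
Proof.
rewrite exprDn coef_sum.
have E (i : 'I_k.+1) : (c%:P ^+ (k - i) * (d *: 'X) ^+ i *+ 'C(k, i))`_j =
    (c ^+ (k - i) * d ^+ i * (j == i)%:R) *+ 'C(k, i).
  by rewrite coefMn -rmorphXn exprZn coefCM coefZ coefXn mulrA.
rewrite (eq_bigr _ (fun i _ => E i)).
have [jk|kj] := leqP j k.
  rewrite (bigD1 (Ordinal (jk : (j < k.+1)%N))) //= eqxx mulr1 big1 ?addr0 // => i.
  by rewrite -val_eqE /= eq_sym => /negbTE ->; rewrite mulr0 mul0rn.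
rewrite bin_small // mulr0n big1 // => i _.
have -> : (j == i) = false by apply/eqP => ji; have := ltn_ord i; rewrite -ji ltnS leqNgt kj.
by rewrite mulr0 mul0rn.
Qed.

Lemma size_rowp M n k : (k <= n)%N -> (size (rowp M n k) <= n.+1)%N.
Proof.
move=> kn; have szl i : (size (lin M i) <= 2)%N.
  apply: leq_trans (size_polyD _ _) _; rewrite geq_max size_polyC.
  rewrite (leq_trans (size_scale_leq _ _)) ?size_polyX //.
  by case: (_ != 0).
have sz i m : (size (lin M i ^+ m) <= m.+1)%N.
  apply: leq_trans (size_poly_exp_leq _ _) _; rewrite ltnS -[leqRHS]mul1n leq_mul2r.
  by have := szl i; case: (size _) => [|[|[|]]] //=; rewrite orbT.
apply: leq_trans (size_polyMleq _ _) _.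
by have := sz ix (n - k)%N; have := sz iy k; lia.
Qed.

Definition symM n M : 'M[K]_n.+1 := \matrix_(i, j) (rowp M n i)`_j.

(* How the normalised coefficients of a binary form of degree n change under
   f |-> f(x . M). *)
Definition sact n M a k : K := coef_fun a (rowp M n k).

Lemma sactE n M a (i : 'I_n.+1) : sact n M a i = \sum_j symM n M i j * a j.
Proof.
rewrite /sact (@coef_funE _ _ n.+1) ?size_rowp -1?ltnS //.
by apply: eq_bigr => j _; rewrite mxE.
Qed.

(** Expanding the product of the [lin M (s x)] over index functions [t], each term carries X^(wt t).
    So [sact] is the tensor power of [M] restricted to symmetric tensors. *)
Lemma sact_tensor (X : finType) M a (s : {ffun X -> 'I_2}) :
  \sum_(t : {ffun X -> 'I_2}) (\prod_x M (s x) (t x)) * a (wt t) = sact #|X| M a (wt s).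
Proof.
rewrite /sact /rowp -(prod_wt s (lin M)).
have -> : \prod_x lin M (s x) = \sum_(t : {ffun X -> 'I_2})
    (\prod_x M (s x) (t x)) *: 'X^(wt t).
  rewrite (eq_bigr (fun x => \sum_(c : 'I_2) M (s x) c *: 'X^c)); last first.
    by move=> x _; rewrite big_ord2 /lin /= expr0 expr1 alg_polyC.
  rewrite (bigA_distr_bigA (fun x (c : 'I_2) => M (s x) c *: 'X^c)).
  by apply: eq_bigr => t _; rewrite scaler_prod /wt expr_sum.
by rewrite coef_fun_sum; apply: eq_bigr => t _; rewrite coef_funXn.
Qed.

(** The Veronese vector: the normalised coefficients of the n-th power of a linear form. *)
Definition vand n (x : 'cV[K]_2) k : K := x ix 0 ^+ (n - k) * x iy 0 ^+ k.

Definition std n k : {ffun 'I_n -> 'I_2} := [ffun i : 'I_n => if (i < k)%N then iy else ix].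

Lemma wt_std n k : (k <= n)%N -> wt (std n k) = k.
Proof.
move=> kn; rewrite wt_card -sum1_card.
transitivity (\sum_(i < n | (i < k)%N) 1)%N.
  by apply: eq_bigl => i; rewrite inE ffunE; case: ltnP.
by rewrite -(big_ord_widen n (fun=> 1%N) kn) sum1_card card_ord.
Qed.

Lemma vand_wt (X : finType) x (s : {ffun X -> 'I_2}) :
  vand #|X| x (wt s) = \prod_y x (s y) 0.
Proof. by rewrite (prod_wt s (fun i => x i 0)). Qed.

Lemma sact_vand n M x k : (k <= n)%N -> sact n M (vand n x) k = vand n (M *m x) k.
Proof.
move=> kn; have vandE y (s : {ffun 'I_n -> 'I_2}) : vand n y (wt s) = \prod_i y (s i) 0.
  by rewrite -vand_wt card_ord.
have := sact_tensor M (vand n x) (std n k); rewrite card_ord wt_std // => <-.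
rewrite -[in RHS](wt_std kn) vandE.
rewrite (eq_bigr (fun t : {ffun 'I_n -> 'I_2} =>
   \prod_i (M (std n k i) (t i) * x (t i) 0))); last first.
  by move=> t _; rewrite vandE -big_split.
rewrite -(bigA_distr_bigA (fun i c => M (std n k i) c * x c 0)).
by apply: eq_bigr => i _; rewrite mxE.
Qed.

Definition colv n a : 'cV[K]_n.+1 := \col_k a k.

Lemma symM_colv n M a : symM n M *m colv n a = colv n (sact n M a).
Proof.
apply/colP => k; rewrite !mxE sactE.
by apply: eq_bigr => j _; rewrite !mxE.
Qed.

Lemma symM_vand n M x : symM n M *m colv n (vand n x) = colv n (vand n (M *m x)).
Proof.
by rewrite symM_colv; apply/colP => k; rewrite !mxE sact_vand // -ltnS.
Qed.

Definition pt (u : K) : 'cV[K]_2 := \col_i u ^+ i.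

Lemma pt_ix u : pt u ix 0 = 1. Proof. by rewrite mxE. Qed.
Lemma pt_iy u : pt u iy 0 = u. Proof. by rewrite mxE. Qed.

(** A row of [A] applied to (1, u, ..., u^n) is the polynomial in u with that row as coefficients.
    Identities between symmetric powers can thus be checked on Veronese vectors, where [symM] just
    moves the point. *)
Lemma vand_separate m n (A : 'M[K]_(m, n.+1)) :
  (forall u, A *m colv n (vand n (pt u)) = 0) -> A = 0.
Proof.
move=> A0; apply/matrixP => r j; rewrite mxE.
have : \poly_(k < n.+1) A r (inord k) = 0.
  apply: poly_eq0_of_values => u; rewrite horner_poly.
  have /matrixP /(_ r 0) := A0 u; rewrite !mxE => E; rewrite -[RHS]E.
  by apply: eq_bigr => k _; rewrite mxE /vand pt_ix pt_iy expr1n mul1r inord_val.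
by move/(congr1 (fun p : {poly K} => p`_j)); rewrite coef_poly ltn_ord inord_val coef0.
Qed.

Lemma vand_separate2 m n (A : 'M[K]_(m.+1, n.+1)) :
  (forall u v, (colv m (vand m (pt u)))^T *m A *m colv n (vand n (pt v)) = 0) -> A = 0.
Proof.
move=> A0; apply: vand_separate => v; apply: trmx_inj; rewrite trmx0.
apply: vand_separate => u; apply: trmx_inj.
by rewrite trmx0 -[RHS](A0 u v) !trmx_mul !trmxK mulmxA.
Qed.

Lemma symM_mul n M M' : symM n (M *m M') = symM n M *m symM n M'.
Proof.
apply/eqP; rewrite -subr_eq0; apply/eqP; apply: vand_separate => u.
by rewrite mulmxBl -mulmxA !symM_vand -mulmxA subrr.
Qed.

Lemma symM_1 n : symM n 1%:M = 1%:M.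
Proof.
apply/eqP; rewrite -subr_eq0; apply/eqP; apply: vand_separate => u.
by rewrite mulmxBl symM_vand !mul1mx subrr.
Qed.

Lemma symM_unit n M : M \in unitmx -> symM n M \in unitmx.
Proof.
move=> uM; have E : symM n M *m symM n (invmx M) = 1%:M.
  by rewrite -symM_mul mulmxV // symM_1.
by case: (mulmx1_unit E).
Qed.

(** Both sides are the sum of the products of the M (s x) (t x) over all [s] of weight i and [t] of
    weight j, in which rows and columns play the same part. *)
Lemma symM_tr n M (i j : 'I_n.+1) :
  'C(n, i)%:R * symM n M i j = symM n M^T j i * 'C(n, j)%:R.
Proof.
have E M' (k l : 'I_n.+1) : 'C(n, k)%:R * symM n M' k l =
    \sum_(s : {ffun 'I_n -> 'I_2} | wt s == k)
    \sum_(t : {ffun 'I_n -> 'I_2} | wt t == l) \prod_x M' (s x) (t x).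
  rewrite (eq_bigr (fun=> symM n M' k l)) => [|s /eqP ws].
    rewrite sumr_const mulr_natl; congr (_ *+ _).
    by have := card_wt 'I_n k; rewrite card_ord => <-; apply: eq_card => s; rewrite !inE.
  rewrite big_mkcond /= (eq_bigr (fun t : {ffun 'I_n -> 'I_2} =>
    (\prod_x M' (s x) (t x)) * (wt t == l)%:R)); last first.
    by move=> t _; case: eqP => _; rewrite ?mulr1 ?mulr0.
  rewrite (sact_tensor M' (fun m => (m == l)%:R)) card_ord ws sactE.
  rewrite (bigD1 l) //= eqxx mulr1 big1 ?addr0 // => m.
  by rewrite -val_eqE /= => /negbTE ->; rewrite mulr0.
rewrite E [RHS]mulrC E exchange_big /=; apply: eq_bigr => s _; apply: eq_bigr => t _.
by apply: eq_bigr => x _; rewrite mxE.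
Qed.

Lemma sact_split m n M a i j : (i <= m)%N -> (j <= n)%N ->
  sact (m + n) M a (i + j) =
  \sum_(k < m.+1) \sum_(l < n.+1) (rowp M m i)`_k * (rowp M n j)`_l * a (k + l)%N.
Proof.
move=> im jn; rewrite /sact.
have -> : rowp M (m + n) (i + j) = rowp M m i * rowp M n j.
  by rewrite /rowp subnDA -addnBAC // -addnBA // !exprD; ring.
have sum (p : {poly K}) N : (size p <= N)%N -> p = \sum_(k < N) p`_k *: 'X^k.
  move=> sz; rewrite -poly_def; apply/polyP => k; rewrite coef_poly.
  by case: ltnP => // /(leq_trans sz) /(nth_default 0) ->.
rewrite {1}(sum _ _ (size_rowp M im)) {1}(sum _ _ (size_rowp M jn)) mulr_suml.
under eq_bigr => k _ do rewrite mulr_sumr.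
rewrite pair_bigA /= (eq_bigr (fun p : 'I_m.+1 * 'I_n.+1 =>
  ((rowp M m i)`_p.1 * (rowp M n j)`_p.2) *: 'X^(p.1 + p.2))); last first.
  by move=> p _; rewrite -scalerAl -scalerAr scalerA exprD.
rewrite coef_fun_sum [RHS]pair_bigA /=.
by apply: eq_bigr => p _; rewrite coef_funXn.
Qed.

Lemma det2E (M : 'M[K]_2) : \det M = M ix ix * M iy iy - M ix iy * M iy ix.
Proof.
rewrite (expand_det_row _ ix) big_ord2 /cofactor !det_mx11 !mxE.
have -> : lift ix 0 = iy by apply: val_inj.
have -> : lift iy 0 = ix by apply: val_inj.
by rewrite /= addn0 add0n; ring.
Qed.

(** [symM] is again lower triangular, and its diagonal product is the power of [\det M] with
    exponent n(n+1)/2; squaring avoids the halved exponent. *)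
Lemma symM_det_lower n M : M ix iy = 0 ->
  (\det (symM n M)) ^+ 2 = \det M ^+ (n * n.+1).
Proof.
move=> M01; have E (i j : 'I_n.+1) : symM n M i j =
    M ix ix ^+ (n - i) * (M iy ix ^+ (i - j) * M iy iy ^+ j *+ 'C(i, j)).
  rewrite mxE /rowp {1}/lin M01 scale0r addr0 -rmorphXn coefCM; congr (_ * _).
  by rewrite coef_linX.
rewrite det_trig; last first.
  by apply/is_trig_mxP => i j ij; rewrite E bin_small // mulr0n mulr0.
rewrite (eq_bigr (fun i : 'I_n.+1 => M ix ix ^+ (n - i) * M iy iy ^+ i)); last first.
  by move=> i _; rewrite E subnn binn mul1r.
have S : (\sum_(i < n.+1) i = 'C(n.+1, 2))%N.
  by rewrite -triangular_sum big_mkord.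
rewrite big_split /= !prodrXr S (reindex_inj rev_ord_inj) /=.
under eq_bigr => i _ do rewrite subSS subKn -1?ltnS //.
rewrite S -exprMn -exprM det2E M01 mul0r subr0; congr (_ ^+ _).
by have := mul_bin_diag n.+1 1; rewrite bin1 /=; lia.
Qed.

Lemma mx2P (M M' : 'M[K]_2) : M ix ix = M' ix ix -> M ix iy = M' ix iy ->
  M iy ix = M' iy ix -> M iy iy = M' iy iy -> M = M'.
Proof.
move=> *; apply/matrixP => i j.
by case: (ord2E i) => ->; case: (ord2E j) => ->.
Qed.

Definition mx2 (a b c d : K) : 'M[K]_2 := \matrix_(i, j)
  if i == ix then if j == ix then a else b else if j == ix then c else d.

(** A matrix with nonzero corner is lower times upper triangular, the upper factor being a lower one
    conjugated by the swap [W]; otherwise [M *m W] has nonzero corner. Squaring, and the evenness of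
    n(n+1), remove the signs due to [W]. *)
Lemma symM_det n M : M \in unitmx -> (\det (symM n M)) ^+ 2 = \det M ^+ (n * n.+1).
Proof.
pose W := mx2 0 1 1 0.
have mulE (A B : 'M[K]_2) i j : (A *m B) i j = A i ix * B ix j + A i iy * B iy j.
  by rewrite mxE big_ord2.
have WW : W *m W = 1%:M by apply: mx2P; rewrite mulE !mxE /=; ring.
have detW : (\det (symM n W)) ^+ 2 = 1.
  by rewrite expr2 -det_mulmx -symM_mul WW symM_1 det1.
have odet : (\det W) ^+ (n * n.+1) = 1.
  have -> : \det W = -1 by rewrite det2E !mxE /=; ring.
  by rewrite -signr_odd oddM /= andbN.
have key (A : 'M[K]_2) : A ix ix != 0 -> (\det (symM n A)) ^+ 2 = \det A ^+ (n * n.+1).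
  move=> a0; pose L := mx2 1 0 (A iy ix / A ix ix) 1.
  pose L' := mx2 (A iy iy - A iy ix / A ix ix * A ix iy) 0 (A ix iy) (A ix ix).
  have -> : A = L *m (W *m L' *m W).
    by apply: mx2P; rewrite !mulE !mxE /=; field.
  rewrite !symM_mul !det_mulmx !exprMn !detW odet (symM_det_lower n (M := L)) ?mxE //.
  by rewrite (symM_det_lower n (M := L')) ?mxE.
move=> uM; have [a0|] := eqVneq (M ix ix) 0; last exact: key.
have b0 : M ix iy != 0.
  by apply: contraTneq uM => b0; rewrite unitmxE det2E a0 b0 !mul0r subrr unitr0.
have := key (M *m W); rewrite mulE !mxE /= mulr0 add0r mulr1 => /(_ b0).
by rewrite symM_mul !det_mulmx !exprMn detW odet !mulr1.
Qed.

End SymmetricPowers.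

(** * Binary forms through their coefficients *)

Section Forms.
Variable K : numFieldType.
Implicit Types (f g : {mpoly K[2]}) (phi : nat -> K) (M : 'M[K]_2).

Definition bmon n k : 'X_{1.. 2} := [multinom [tuple (n - k)%N; k]].

Lemma bmon_ix n k : bmon n k ix = (n - k)%N. Proof. by []. Qed.
Lemma bmon_iy n k : bmon n k iy = k. Proof. by []. Qed.

Lemma bcoefE n f k : bcoef n f k = f@_(bmon n k). Proof. by []. Qed.

Lemma mnm2_eq (m m' : 'X_{1.. 2}) : m ix = m' ix -> m iy = m' iy -> m = m'.
Proof. by move=> ex ey; apply/mnmP => i; case: (ord2E i) => ->. Qed.

Lemma mdeg2 (m : 'X_{1.. 2}) : mdeg m = (m ix + m iy)%N.
Proof. by rewrite mdegE big_ord2. Qed.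

Lemma mdeg_bmon n k : (k <= n)%N -> mdeg (bmon n k) = n.
Proof. by move=> kn; rewrite mdeg2 bmon_ix bmon_iy subnK. Qed.

Lemma bmon_mdeg (m : 'X_{1.. 2}) : m = bmon (mdeg m) (m iy).
Proof. by apply: mnm2_eq; rewrite ?bmon_ix ?bmon_iy // mdeg2 addnK. Qed.

Lemma bcoefX n k j : bcoef n ('X_[bmon n k] : {mpoly K[2]}) j = (k == j)%:R.
Proof.
rewrite bcoefE mcoeffX; case: (k =P j) => [->|neq]; first by rewrite eqxx.
by case: eqP => // /(congr1 (fun m : 'X_{1.. 2} => m iy)).
Qed.

Lemma bcoef_gt n f k : f \is n.-homog -> (n < k)%N -> bcoef n f k = 0.
Proof.
move=> hf nk; rewrite bcoefE; apply: (dhomog_nemf_coeff hf).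
by rewrite /= mdeg2 bmon_ix bmon_iy; apply/eqP; lia.
Qed.

Lemma homog_eq n f g : f \is n.-homog -> g \is n.-homog ->
  (forall k, (k <= n)%N -> bcoef n f k = bcoef n g k) -> f = g.
Proof.
move=> hf hg E; apply/mpolyP => m; have [dm|dm] := eqVneq (mdeg m) n.
  by rewrite (bmon_mdeg m) dm; apply: E; rewrite -dm mdeg2 leq_addl.
by rewrite (dhomog_nemf_coeff hf) // (dhomog_nemf_coeff hg).
Qed.

Lemma homog_bmon_sum n (c : nat -> K) :
  \sum_(k < n.+1) c k *: 'X_[bmon n k] \is n.-homog.
Proof.
by apply: rpred_sum => k _; apply: dhomogZ; rewrite dhomogX /= mdeg_bmon // -ltnS.
Qed.

Lemma bcoef_sum n (c : nat -> K) j : (j <= n)%N ->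
  bcoef n (\sum_(k < n.+1) c k *: 'X_[bmon n k]) j = c j.
Proof.
move=> jn; rewrite bcoefE raddf_sum (bigD1 (Ordinal (jn : (j < n.+1)%N))) //=.
rewrite mcoeffZ -bcoefE bcoefX eqxx mulr1 big1 ?addr0 // => k.
by rewrite -val_eqE /= mcoeffZ -bcoefE bcoefX => /negbTE ->; rewrite mulr0.
Qed.

Lemma homog_sum n f : f \is n.-homog ->
  f = \sum_(k < n.+1) bcoef n f k *: 'X_[bmon n k].
Proof.
move=> hf; apply: homog_eq hf (homog_bmon_sum _ _) _ => k kn.
by rewrite bcoef_sum.
Qed.

(** The form with normalised coefficients [phi]: the C(n, k) index functions of weight k supply the
    binomials. *)
Definition form n phi : {mpoly K[2]} :=
  \sum_(t : {ffun 'I_n -> 'I_2}) phi (wt t) *: \prod_a 'X_(t a).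

Lemma form_monE n (t : {ffun 'I_n -> 'I_2}) :
  \prod_a 'X_(t a) = 'X_[bmon n (wt t)] :> {mpoly K[2]}.
Proof.
rewrite (prod_wt t (fun i => 'X_i)) card_ord !mpolyXn -mpolyXD.
congr 'X_[_]; apply: mnm2_eq;
  by rewrite mnmDE !mulmnE !mnm1E ?bmon_ix ?bmon_iy /= ?mul1n ?mul0n ?addn0.
Qed.

Lemma form_homog n phi : form n phi \is n.-homog.
Proof.
apply: rpred_sum => t _; apply: dhomogZ; rewrite form_monE dhomogX /= mdeg_bmon //.
by have := wt_le t; rewrite card_ord.
Qed.

Lemma bcoef_form n phi k : bcoef n (form n phi) k = 'C(n, k)%:R * phi k.
Proof.
rewrite bcoefE raddf_sum /=.
rewrite (eq_bigr (fun t : {ffun 'I_n -> 'I_2} => (wt t == k)%:R * phi k)); last first.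
  move=> t _; rewrite mcoeffZ form_monE -bcoefE bcoefX mulrC.
  by case: eqP => [->|]; rewrite ?mul0r.
rewrite -mulr_suml -natr_sum; congr (_%:R * _).
have := card_wt 'I_n k; rewrite card_ord => <-; rewrite -sum1_card [RHS]big_mkcond /=.
by apply: eq_bigr => t _; rewrite inE; case: eqP.
Qed.

Definition ncoef n f k : K := bcoef n f k / 'C(n, k)%:R.

Lemma bin_neq0 n k : (k <= n)%N -> 'C(n, k)%:R != 0 :> K.
Proof. by move=> kn; rewrite pnatr_eq0 -lt0n bin_gt0. Qed.

Lemma homog_form n f : f \is n.-homog -> f = form n (ncoef n f).
Proof.
move=> hf; apply: homog_eq hf (form_homog _ _) _ => k kn.
by rewrite bcoef_form /ncoef mulrC divfK // bin_neq0.
Qed.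

Lemma ncoef_form n phi k : (k <= n)%N -> ncoef n (form n phi) k = phi k.
Proof. by move=> kn; rewrite /ncoef bcoef_form mulrAC divff ?mul1r // bin_neq0. Qed.

Lemma row_subst_form n M phi : row_subst M (form n phi) = form n (sact n M phi).
Proof.
rewrite /row_subst /form raddf_sum /=.
pose l j : {mpoly K[2]} := \sum_(i < 2) M i j *: 'X_i.
transitivity (\sum_(s : {ffun 'I_n -> 'I_2}) \sum_(t : {ffun 'I_n -> 'I_2})
   (phi (wt s) * \prod_x M (t x) (s x)) *: \prod_x 'X_(t x) : {mpoly K[2]}).
  apply: eq_bigr => s _; rewrite comp_mpolyZ rmorph_prod /=.
  rewrite (eq_bigr (fun x => \sum_(i < 2) M i (s x) *: 'X_i)); last first.
    by move=> x _; rewrite comp_mpolyXU -tnth_nth tnth_mktuple.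
  rewrite (bigA_distr_bigA (fun x (i : 'I_2) => M i (s x) *: ('X_i : {mpoly K[2]}))).
  rewrite scaler_sumr; apply: eq_bigr => t _.
  by rewrite scaler_prod scalerA.
rewrite exchange_big; apply: eq_bigr => t _.
have := sact_tensor M phi t; rewrite card_ord => <-.
by rewrite scaler_suml; apply: eq_bigr => s _; rewrite mulrC.
Qed.

Lemma row_subst_homog n M f : f \is n.-homog -> row_subst M f \is n.-homog.
Proof. by move=> /homog_form ->; rewrite row_subst_form form_homog. Qed.

Lemma ncoef_row_subst n M f k : f \is n.-homog -> (k <= n)%N ->
  ncoef n (row_subst M f) k = sact n M (ncoef n f) k.
Proof. by move=> hf kn; rewrite {1}(homog_form hf) row_subst_form ncoef_form. Qed.

Lemma gen_coef_eval n phi k M : (gen_coef n phi k).@[fun i => mxvec M 0 i] =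
  bcoef n (row_subst M (form n phi)) k.
Proof.
rewrite row_subst_form bcoef_form raddf_sum /=.
rewrite (eq_bigr (fun s : {ffun 'I_n -> 'I_2} => (wt s == k)%:R * sact n M phi k)).
  rewrite -mulr_suml -natr_sum; congr (_%:R * _).
  have := card_wt 'I_n k; rewrite card_ord => <-; rewrite -sum1_card [RHS]big_mkcond /=.
  by apply: eq_bigr => s _; rewrite inE; case: eqP.
move=> s _; rewrite raddf_sum /=.
case: (wt s =P k) => [<-|neq]; last first.
  by rewrite mul0r big1 // => t _; rewrite mul0r scale0r raddf0.
have := sact_tensor M phi s; rewrite card_ord mul1r => <-.
apply: eq_bigr => t _; rewrite mul1r mevalZ mulrC; congr (_ * _).
rewrite rmorph_prod /=; apply: eq_bigr => x _.
by rewrite /gen mevalXU mxvecE.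
Qed.

Lemma homog_deriv n f i : f \is n.+1.-homog -> f^`M(i) \is n.-homog.
Proof.
move=> hf; apply/dhomogP => m; rewrite mcoeff_msupp mcoeff_deriv => nz.
apply/eqP; apply: contraNT nz => dm.
rewrite (dhomog_nemf_coeff hf) ?mul0rn //= mdegD mdeg1 addn1.
by rewrite eqSS.
Qed.

Lemma bcoef_deriv_ix n f k : (k <= n)%N ->
  bcoef n f^`M(ix) k = (n.+1 - k)%:R * bcoef n.+1 f k.
Proof.
move=> kn; rewrite !bcoefE mcoeff_deriv bmon_ix mulr_natl -subSn //; congr (_@_ _ *+ _).
by apply: mnm2_eq; rewrite mnmDE mnm1E ?bmon_ix ?bmon_iy /= ?addn0 // addn1 subSn.
Qed.

Lemma bcoef_deriv_iy n f k :
  bcoef n f^`M(iy) k = k.+1%:R * bcoef n.+1 f k.+1.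
Proof.
rewrite !bcoefE mcoeff_deriv bmon_iy mulr_natl; congr (_@_ _ *+ _).
by apply: mnm2_eq; rewrite mnmDE mnm1E ?bmon_ix ?bmon_iy /= ?addn0 // addn1.
Qed.

(** In normalised coefficients f_x and f_y are, up to the factor [n.+1], the sequence of f and its
    shift by one; this identifies f_x /\ f_y with [wedge]. *)
Lemma bcoef_grad_ix n f k : (k <= n)%N ->
  bcoef n f^`M(ix) k = n.+1%:R * 'C(n, k)%:R * ncoef n.+1 f k.
Proof.
move=> kn; rewrite bcoef_deriv_ix // /ncoef.
have kn1 : (k <= n.+1)%N by apply: leqW.
have -> : n.+1%:R * 'C(n, k)%:R = (n.+1 - k)%:R * 'C(n.+1, k)%:R :> K.
  by rewrite -!natrM mul_bin_diag mul_bin_left.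
by rewrite -mulrA [_%:R * (_ / _)]mulrC divfK ?bin_neq0.
Qed.

Lemma bcoef_grad_iy n f k : (k <= n)%N ->
  bcoef n f^`M(iy) k = n.+1%:R * 'C(n, k)%:R * ncoef n.+1 f k.+1.
Proof.
move=> kn; rewrite bcoef_deriv_iy // /ncoef.
have -> : n.+1%:R * 'C(n, k)%:R = k.+1%:R * 'C(n.+1, k.+1)%:R :> K.
  by rewrite -!natrM mul_bin_diag.
by rewrite -mulrA [_%:R * (_ / _)]mulrC divfK ?bin_neq0.
Qed.

Definition dehom n f : {poly K} := \poly_(k < n.+1) bcoef n f k.

Lemma coef_dehom n f k : f \is n.-homog -> (dehom n f)`_k = bcoef n f k.
Proof.
by move=> hf; rewrite coef_poly ltnS; case: leqP => // /(bcoef_gt hf).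
Qed.

Lemma dehom_eval n f u : f \is n.-homog ->
  (dehom n f).[u] = f.@[fun i => pt u i 0].
Proof.
move=> hf; rewrite {2}(homog_sum hf) raddf_sum horner_poly; apply: eq_bigr => k _.
by rewrite /= mevalZ mevalX big_prod2 bmon_iy bmon_ix pt_ix pt_iy expr1n mul1r.
Qed.

Lemma bcoefM m n f g k : f \is m.-homog -> g \is n.-homog ->
  bcoef (m + n) (f * g) k = \sum_(i < k.+1) bcoef m f i * bcoef n g (k - i).
Proof.
move=> hf hg; have hfg := dhomogM hf hg.
have E : dehom (m + n) (f * g) = dehom m f * dehom n g.
  apply/eqP; rewrite -subr_eq0; apply/eqP; apply: poly_eq0_of_values => u.
  by rewrite hornerD hornerN hornerM !dehom_eval // mevalM subrr.
rewrite -coef_dehom // E coefM; apply: eq_bigr => i _.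
by rewrite !coef_dehom.
Qed.

End Forms.

(** * Bezoutians and resultants *)

Section Bezoutian.
Variable K : numFieldType.

Lemma vand_pt n (u : K) k : vand n (pt u) k = u ^+ k.
Proof. by rewrite /vand pt_ix pt_iy expr1n mul1r. Qed.

Section Wedge.
Variable N : nat.
Implicit Types B : 'M[K]_N.+1.

Definition mulx : 'M[K]_(N.+1, N.+2) := \matrix_(i, j) (i == j :> nat)%:R.
Definition muly : 'M[K]_(N.+1, N.+2) := \matrix_(i, j) (i.+1 == j :> nat)%:R.

(* The coefficients of (x y' - x' y) B(x, y; x', y'). *)
Definition wedge_mx B : 'M[K]_N.+2 := mulx^T *m B *m muly - muly^T *m B *m mulx.

Lemma mulx_vand x : mulx *m colv N.+1 (vand N.+1 x) = x ix 0 *: colv N (vand N x).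
Proof.
apply/colP => k; rewrite !mxE (bigD1 (widen_ord (leqnSn _) k)) //= !mxE /= eqxx mul1r.
rewrite big1 ?addr0 => [|j]; last first.
  by rewrite -val_eqE /= !mxE eq_sym => /negbTE ->; rewrite mul0r.
by rewrite /vand subSn -1?ltnS // exprS mulrA.
Qed.

Lemma muly_vand x : muly *m colv N.+1 (vand N.+1 x) = x iy 0 *: colv N (vand N x).
Proof.
apply/colP => k; rewrite !mxE (bigD1 (lift ord0 k)) //= !mxE /= eqxx mul1r.
rewrite big1 ?addr0 => [|j]; last first.
  by rewrite -val_eqE /= !mxE eq_sym => /negbTE ->; rewrite mul0r.
by rewrite /vand subSS exprS mulrCA.
Qed.

Definition bilin n (A : 'M[K]_n.+1) (x y : 'cV[K]_2) : 'M[K]_1 :=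
  (colv n (vand n x))^T *m A *m colv n (vand n y).

Lemma bilinE n (A : 'M[K]_n.+1) x y : bilin A x y 0 0 =
  \sum_(k < n.+1) (A *m colv n (vand n y)) k 0 * vand n x k.
Proof.
rewrite /bilin -mulmxA mxE; apply: eq_bigr => k _.
by rewrite [X in X * _]mxE [X in X * _]mxE mulrC.
Qed.

Lemma wedge_mx_bilin B x y : bilin (wedge_mx B) x y =
  (x ix 0 * y iy 0 - x iy 0 * y ix 0) *: bilin B x y.
Proof.
rewrite /bilin /wedge_mx mulmxBr mulmxBl !mulmxA.
rewrite -!trmx_mul mulx_vand muly_vand.
rewrite -!mulmxA mulx_vand muly_vand !linearZ /= -!scalemxAl.
by rewrite scalerN !scalerA -scalerBl [y iy 0 * _]mulrC [y ix 0 * _]mulrC.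
Qed.

Lemma wedge_mx_scale c B : wedge_mx (c *: B) = c *: wedge_mx B.
Proof. by rewrite /wedge_mx -!scalemxAr -!scalemxAl -scalerBr. Qed.

Lemma wedge_mxB B B' : wedge_mx (B - B') = wedge_mx B - wedge_mx B'.
Proof.
rewrite /wedge_mx !mulmxBr !mulmxBl !opprB addrACA [RHS]addrACA.
by congr (_ + _); rewrite addrC.
Qed.

(** At the points (1, u) and (1, v) the bracket is v - u, and multiplication by it is injective on
    polynomials in u. *)
Lemma wedge_mx_inj : injective wedge_mx.
Proof.
move=> B B' E; apply/eqP; rewrite -subr_eq0; apply/eqP.
have {E} : wedge_mx (B - B') = 0.
  by rewrite wedge_mxB E subrr.
move: (B - B') => {}B E; apply: vand_separate => v; apply: trmx_inj; rewrite trmx0.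
apply: vand_separate.
have key : (B *m colv N (vand N (pt v)))^T = 0.
  pose c := (B *m colv N (vand N (pt v)))^T.
  have p0 : ('X - v%:P) * (\poly_(k < N.+1) c 0 (inord k)) = 0.
    apply: poly_eq0_of_values => u; rewrite hornerM hornerXsubC horner_poly.
    have := wedge_mx_bilin B (pt u) (pt v); rewrite E {1}/bilin mulmx0 mul0mx.
    rewrite !pt_ix !pt_iy mul1r mulr1 => /matrixP /(_ 0 0).
    rewrite [LHS]mxE [RHS]mxE bilinE => H.
    rewrite -[u - v]opprB mulNr; apply/eqP; rewrite oppr_eq0; apply/eqP.
    rewrite [RHS]H; congr (_ * _); apply: eq_bigr => k _.
    by rewrite /c [X in X * _]mxE inord_val vand_pt.
  apply/rowP => j; rewrite [RHS]mxE.
  move/eqP: p0; rewrite mulf_eq0 polyXsubC_eq0 /= => /eqP p0.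
  have := congr1 (fun p : {poly K} => p`_j) p0.
  by rewrite coef_poly ltn_ord coef0 inord_val.
by move=> u; rewrite key mul0mx.
Qed.

(** The bracket of [M *m x] and [M *m y] is [\det M] times that of x and y. *)
Lemma wedge_mx_symM B M : \det M *: wedge_mx ((symM N M)^T *m B *m symM N M) =
  (symM N.+1 M)^T *m wedge_mx B *m symM N.+1 M.
Proof.
apply/eqP; rewrite -subr_eq0; apply/eqP; apply: vand_separate2 => u v.
have bilinM n (A : 'M[K]_n.+1) x y :
    bilin ((symM n M)^T *m A *m symM n M) x y = bilin A (M *m x) (M *m y).
  by rewrite /bilin -!symM_vand trmx_mul !mulmxA.
rewrite mulmxBr mulmxBl -scalemxAr -scalemxAl -!/(bilin _ _ _).
rewrite bilinM !wedge_mx_bilin bilinM scalerA -scalerBl.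
have mulE x i : (M *m x) i 0 = M i ix * x ix 0 + M i iy * x iy (0 : 'I_1).
  by rewrite mxE big_ord2.
rewrite det2E !mulE; set c := (X in X *: _).
by have -> : c = 0; rewrite ?scale0r // /c; ring.
Qed.

Lemma wedge_mxE (b : nat -> nat -> K) (k l : 'I_N.+2) :
  (forall i j, (N < i)%N || (N < j)%N -> b i j = 0) ->
  wedge_mx (\matrix_(i, j) b i j) k l =
  (if (l : nat) is l'.+1 then b k l' else 0) - (if (k : nat) is k'.+1 then b k' l else 0).
Proof.
move=> b0.
have E1 (f : nat -> K) (m : 'I_N.+2) : (forall i, (N < i)%N -> f i = 0) ->
    \sum_(i < N.+1) f i * (i == m :> nat)%:R = f m.
  move=> f0; have [mN|Nm] := ltnP m N.+1.
    rewrite (bigD1 (Ordinal mN)) //= eqxx mulr1 big1 ?addr0 // => i.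
    by rewrite -val_eqE /= => /negbTE ->; rewrite mulr0.
  rewrite f0 // big1 // => i _; case: eqP => [E|]; rewrite ?mulr0 //.
  by have := ltn_ord i; rewrite E ltnNge Nm.
have E2 (f : nat -> K) (m : 'I_N.+2) :
    \sum_(i < N.+1) f i * (i.+1 == m :> nat)%:R = if (m : nat) is m'.+1 then f m' else 0.
  case: m => [[|m] /= mN]; first by rewrite big1 // => i _; rewrite mulr0.
  rewrite (bigD1 (Ordinal (mN : (m < N.+1)%N))) //= eqxx mulr1 big1 ?addr0 // => i.
  by rewrite -val_eqE /= eqSS => /negbTE ->; rewrite mulr0.
rewrite /wedge_mx !mxE; congr (_ - _).
  transitivity (\sum_(j < N.+1) b k j * (j.+1 == l :> nat)%:R); last exact: E2.
  apply: eq_bigr => j _; rewrite !mxE; congr (_ * _).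
  rewrite -(E1 (fun i => b i j)) => [|i iN]; last by rewrite b0 ?iN.
  by apply: eq_bigr => i _; rewrite !mxE mulrC.
rewrite -(E2 (fun i => b i l)).
transitivity (\sum_(j < N.+1) \sum_(i < N.+1) b i j * (i.+1 == k)%:R * (j == l :> nat)%:R).
  apply: eq_bigr => j _; rewrite !mxE mulr_suml; apply: eq_bigr => i _.
  by rewrite !mxE [_ * b i j]mulrC.
rewrite exchange_big; apply: eq_bigr => i _ /=.
rewrite -(E1 (fun j => b i j)) => [|j jN]; last by rewrite b0 ?jN ?orbT.
by rewrite mulr_suml; apply: eq_bigr => j _; rewrite mulrAC.
Qed.

End Wedge.

Section Bez.
Variable N : nat.
Implicit Types p q a : nat -> K.

Definition cross p q k l : K := p k * q l - q k * p l.

(** The coefficient of u^k v^l in (p(u) q(v) - q(u) p(v)) / (v - u). It is defined on all of nat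
    and, for [supported] p and q, vanishes outside the square, so that recurrences can run past the
    border. *)
Definition bezf p q k l : K := \sum_(i < k.+1) cross p q i (k + l.+1 - i).

Definition bez p q : 'M[K]_N.+1 := \matrix_(k, l) bezf p q k l.

Definition supported p := forall k, (N.+1 < k)%N -> p k = 0.

Lemma bezf0 p q l : bezf p q 0 l = cross p q 0 l.+1.
Proof. by rewrite /bezf big_ord1. Qed.

Lemma bezfS p q k l : bezf p q k.+1 l = bezf p q k l.+1 + cross p q k.+1 l.+1.
Proof.
rewrite /bezf big_ord_recr /= addSn; congr (_ + cross p q _ _); last by lia.
by apply: eq_bigr => i _; rewrite (addnS k l.+1).
Qed.

Lemma crossxx p q k : cross p q k k = 0.
Proof. by rewrite /cross mulrC subrr. Qed.

Lemma cross_antisym_sum p q m : \sum_(i < m.+1) cross p q i (m - i) = 0.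
Proof.
rewrite /cross sumrB [X in X - _](reindex_inj rev_ord_inj) /=.
apply/eqP; rewrite subr_eq0; apply/eqP; apply: eq_bigr => i _.
by rewrite subSS subKn -1?ltnS // mulrC.
Qed.

Lemma bezf_col0 p q k : bezf p q k 0 = - cross p q k.+1 0.
Proof.
have := cross_antisym_sum p q k.+1; rewrite big_ord_recr /= subnn => /eqP.
rewrite addr_eq0 => /eqP <-; apply: eq_bigr => i _.
by rewrite addn1.
Qed.

Variables p q : nat -> K.
Hypotheses (sp : supported p) (sq : supported q).

Lemma cross_gt k l : (N.+1 < k)%N || (N.+1 < l)%N -> cross p q k l = 0.
Proof.
by case/orP => H; rewrite /cross (sp H) (sq H) ?mul0r ?mulr0 subrr.
Qed.

(** For k > N the sum differs from a full antidiagonal sum of the antisymmetric [cross] only by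
    terms with an index beyond [N.+1]. *)
Lemma bezf_gt k l : (N < k)%N || (N < l)%N -> bezf p q k l = 0.
Proof.
have [lN _|_] := ltnP N l.
  apply: big1 => i _; apply: cross_gt; apply/orP; right.
  by have := ltn_ord i; lia.
rewrite orbF => kN; rewrite -[RHS](cross_antisym_sum p q (k + l.+1)).
rewrite /bezf (big_ord_widen (k + l.+1).+1 (fun i => cross p q i (k + l.+1 - i))); last by lia.
rewrite big_mkcond /=; apply: eq_bigr => i _; case: ltnP => // ki.
by rewrite cross_gt //; apply/orP; left; lia.
Qed.

Lemma wedge_mx_bez : wedge_mx (bez p q) = \matrix_(k, l) cross p q k l.
Proof.
apply/matrixP => k l; rewrite wedge_mxE; last exact: bezf_gt.
rewrite mxE; case: (nat_of_ord k) => [|k']; case: (nat_of_ord l) => [|l'].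
- by rewrite subr0 crossxx.
- by rewrite subr0 bezf0.
- by rewrite sub0r bezf_col0 opprK.
- by rewrite bezfS addrC addKr.
Qed.

Definition hankel a : 'M[K]_N.+1 := \matrix_(i, j) a (i + j)%N.

(* The inverse of a Hankel matrix is a Bezoutian. *)
Lemma hankel_bez a :
    (forall j, (j < N)%N -> \sum_(k < N.+2) a (j + k)%N * p k = 0) ->
    (forall j, (j < N)%N -> \sum_(k < N.+2) a (j + k)%N * q k = 0) ->
  exists c, hankel a *m bez p q = c%:M.
Proof.
move=> ap aq; pose h j l := \sum_(k < N.+1) a (j + k)%N * bezf p q k l.
have across j l : (j < N)%N -> \sum_(k < N.+2) a (j + k)%N * cross p q k l = 0.
  move=> jN; rewrite (eq_bigr (fun k : 'I_N.+2 =>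
    a (j + k)%N * p k * q l - a (j + k)%N * q k * p l)); last by move=> k _; rewrite /cross; ring.
  by rewrite sumrB -!mulr_suml ap // aq // !mul0r subrr.
(* The product is Toeplitz, by the recurrence for [bezf] and the annihilation of p and q. Its first
   column vanishes below the corner ([h0]), and an entry above the diagonal slides to column [N.+1],
   where [bezf] is zero. *)
have hS j l : (j < N)%N -> h j l = h j.+1 l.+1.
  move=> jN; have -> : h j l = \sum_(k < N.+2) a (j + k)%N * bezf p q k l.
    by rewrite big_ord_recr /= bezf_gt ?mulr0 ?addr0 // ltnSn.
  rewrite big_ord_recl bezf0 -[RHS]addr0 -[X in _ = _ + X](across j l.+1 jN).
  rewrite [X in _ = _ + X]big_ord_recl addrCA; congr (_ + _).
  rewrite -big_split; apply: eq_bigr => k _ /=.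
  by rewrite /bump leq0n add1n bezfS addSnnS; ring.
have h0 j : (j < N)%N -> h j.+1 0 = 0.
  move=> jN; apply/eqP; rewrite -oppr_eq0 -[X in _ == X](across j 0%N jN).
  rewrite [X in _ == X]big_ord_recl crossxx mulr0 add0r /h.
  rewrite -sumrN; apply/eqP; apply: eq_bigr => k _.
  by rewrite bezf_col0 mulrN opprK addSnnS.
exists (h 0%N 0%N); apply/matrixP => j l; rewrite !mxE.
have -> : \sum_j0 hankel a j j0 * bez p q j0 l = h j l.
  by apply: eq_bigr => k _; rewrite !mxE.
have diag i m : (i + m <= N)%N -> forall i' : nat, h (i + m)%N (i' + m)%N = h i i'.
  elim: m => [|m IH] H i'; first by rewrite !addn0.
  by rewrite !addnS -hS ?IH //; lia.
rewrite -val_eqE /=.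
have jN := ltn_ord j; have lN := ltn_ord l.
case: (ltngtP j l) => [jl|lj|->].
- rewrite mulr0n; have H : (j + (N - l) <= N)%N by lia.
  rewrite -(diag _ _ H); have -> : (l + (N - l))%N = N by lia.
  rewrite hS; last by lia.
  by apply: big1 => k _; rewrite bezf_gt ?mulr0 // ltnSn orbT.
- rewrite mulr0n; have -> : (j : nat) = ((j - l) + l)%N by lia.
  have := diag (j - l)%N l; rewrite subnK ?(ltnW lj) // -ltnS => /(_ jN 0%N).
  rewrite add0n => ->; have -> : (j - l)%N = (j - l).-1.+1 by lia.
  by apply: h0; lia.
- have := diag 0%N l; rewrite !add0n -ltnS => /(_ lN 0%N).
  by rewrite add0n mulr1n.
Qed.

Lemma big_diag (F : nat -> nat -> K) :
    (forall i j, (N < i)%N || (N < j)%N -> F i j = 0) ->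
  \sum_(k < N.+1) \sum_(i < N.+1) F k i =
  \sum_(m < (N + N).+1) \sum_(k < m.+1) F k (m - k)%N.
Proof.
move=> F0; have leM (m : 'I_(N + N).+1) : (m.+1 <= (N + N).+1)%N by [].
under [RHS]eq_bigr => m _ do
  rewrite (big_ord_widen _ (fun k => F k (m - k)%N) (leM m)) big_mkcond.
rewrite [RHS]exchange_big /=.
have NM : (N.+1 <= (N + N).+1)%N by lia.
rewrite (big_ord_widen _ (fun k => \sum_(i < N.+1) F k i) NM) big_mkcond.
apply: eq_bigr => k _ /=; rewrite -big_mkcond /=; case: ltnP => kN; last first.
  by rewrite big1 // => m _; rewrite F0 ?kN.
rewrite (eq_bigl (fun m : 'I_(N + N).+1 => true && (k <= m)%N)); last by move=> m; rewrite ltnS.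
rewrite -(big_geq_mkord (0 + k)%N _ xpredT (fun m => F k (m - k)%N)) big_addn big_mkord.
have le : (N.+1 <= (N + N).+1 - k)%N by lia.
rewrite (big_ord_widen _ (fun i => F k i) le) big_mkcond; apply: eq_bigr => i _ /=.
by rewrite addnK; case: ltnP => // iN; rewrite F0 ?iN ?orbT.
Qed.

(** The trace sees only the antidiagonal sums of the Bezoutian, i.e. its restriction to u = v; this
    is how the Hessian enters. *)
Lemma trace_hankel_bez a :
  \tr (hankel a *m bez p q) =
  \sum_(m < (N + N).+1) a m * \sum_(i < m.+1) bezf p q i (m - i).
Proof.
rewrite /mxtrace.
transitivity (\sum_(k < N.+1) \sum_(i < N.+1) a (k + i)%N * bezf p q k i).
  rewrite exchange_big; apply: eq_bigr => i _; rewrite mxE; apply: eq_bigr => k _.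
  by rewrite !mxE addnC.
rewrite (big_diag (F := fun k i => a (k + i)%N * bezf p q k i)); last first.
  by move=> i j ij; rewrite bezf_gt ?mulr0.
apply: eq_bigr => m _; rewrite mulr_sumr; apply: eq_bigr => i _.
by rewrite subnKC // -ltnS.
Qed.

End Bez.
End Bezoutian.

(** * Sylvester determinant and Bezoutian *)

Section Sylvester.
Variables (K : numFieldType) (N : nat).
Local Notation n := N.+1.
Implicit Types p q : nat -> K.

Definition sylv_rows p : 'M[K]_(n, n + n) :=
  \matrix_(i < n, j < n + n) if (i <= j <= i + n)%N then p (j - i)%N else 0.

Definition sylv p q : 'M[K]_(n + n) := col_mx (sylv_rows p) (sylv_rows q).

Definition toepU p : 'M[K]_n := \matrix_(i, j) if (i <= j)%N then p (j - i)%N else 0.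
Definition toepL p : 'M[K]_n := \matrix_(i, j) if (j <= i)%N then p (n + j - i)%N else 0.

Lemma sylv_rowsE p : sylv_rows p = row_mx (toepU p) (toepL p).
Proof.
apply/matrixP => i j; rewrite -[j]splitK; case: (split j) => k /=.
  rewrite row_mxEl !mxE /=; congr (if _ then _ else _).
  by have := ltn_ord k; lia.
rewrite row_mxEr !mxE /=; congr (if _ then _ else _).
by have := ltn_ord i; lia.
Qed.

Lemma toepU_comm p q : toepU p *m toepU q = toepU q *m toepU p.
Proof.
have E p' q' (i j : 'I_n) : (toepU p' *m toepU q') i j =
    \sum_(i <= m < j.+1) p' (m - i)%N * q' (j - m)%N.
  rewrite mxE (big_nat_widen _ _ n) ?ltn_ord // big_geq_mkord /= [RHS]big_mkcond.
  apply: eq_bigr => m _; rewrite !mxE ltnS.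
  by case: (i <= m)%N; case: (m <= j)%N; rewrite ?mul0r ?mulr0.
apply/matrixP => i j; rewrite !E big_nat_rev [LHS]big_nat [RHS]big_nat.
apply: eq_bigr => m /andP [im mj]; rewrite mulrC; congr (q _ * p _); lia.
Qed.

(* The Schur complement relating the Sylvester matrix to the Bezoutian. *)
Lemma toep_bez p q : supported N p -> supported N q ->
  toepU q *m toepL p - toepU p *m toepL q =
  - (perm_mx (perm (@rev_ord_inj n)) *m bez N p q).
Proof.
move=> sp sq; rewrite -row_permE; apply/matrixP => i j; rewrite [RHS]mxE mxE !mxE permE.
rewrite -sumrN -big_split /=.
rewrite (eq_bigr (fun m : 'I_n => if (i <= m)%N then - cross p q (m - i) (n + j - m) else 0)); last first.
  move=> m _; rewrite !mxE; case: (i <= m)%N; last by rewrite !mul0r subr0.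
  case: leqP => [jm|mj]; first by rewrite /cross; ring.
  by rewrite (cross_gt sp sq) ?oppr0 ?mulr0 ?subr0 //; apply/orP; right; lia.
rewrite -big_mkcond -(big_geq_mkord (0 + i)%N _ xpredT (fun m => - cross p q (m - i) (n + j - m))).
rewrite big_addn big_mkord sumrN; congr (- _); rewrite /bezf.
have -> : (n - i)%N = (n - i.+1).+1 by have := ltn_ord i; lia.
by apply: eq_bigr => m _; congr (cross p q _ _); have := ltn_ord m; have := ltn_ord i; lia.
Qed.

Lemma det_toepU p : \det (toepU p) = p 0%N ^+ n.
Proof.
rewrite -det_tr det_trig.
  rewrite (eq_bigr (fun=> p 0%N)) ?prodr_const ?card_ord // => i _.
  by rewrite !mxE leqnn subnn.
by apply/is_trig_mxP => i j ij; rewrite !mxE leqNgt ij.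
Qed.

Definition rev_sign : K := (-1) ^+ (perm (@rev_ord_inj n) : bool).

Lemma rev_sign_neq0 : rev_sign != 0.
Proof. by rewrite signr_eq0. Qed.

Lemma det_sylv_aux p q : supported N p -> supported N q -> p 0%N != 0 ->
  \det (sylv p q) = rev_sign * \det (bez N p q).
Proof.
move=> sp sq p0.
(* Block elimination, possible because upper triangular Toeplitz matrices commute. It multiplies the
   determinant by (-1)^n (p 0)^n, which is cancelled at the end. *)
have E : block_mx 1%:M 0 (toepU q) (- toepU p) *m sylv p q =
    block_mx (toepU p) (toepL p) 0 (- (perm_mx (perm (@rev_ord_inj n)) *m bez N p q)).
  rewrite /sylv !sylv_rowsE -/(block_mx _ _ _ _) mulmx_block !mul1mx !mul0mx !addr0.
  by rewrite !mulNmx toepU_comm subrr toep_bez.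
have := congr1 determinant E.
rewrite det_mulmx det_lblock det_ublock det1 mul1r.
rewrite -!scaleN1r !detZ det_mulmx det_perm !det_toepU => H.
have s0 : (-1) ^+ n != 0 :> K by rewrite signr_eq0.
apply: (mulfI (mulf_neq0 s0 (expf_neq0 n p0))); rewrite H -/rev_sign.
by rewrite mulrCA mulrA.
Qed.

(** If p 0 = 0 but q 0 is nonzero, replacing p by p + q changes neither side. If both vanish, the
    first column of the Sylvester matrix and the first row of the Bezoutian are zero. *)
Lemma det_sylv p q : supported N p -> supported N q ->
  \det (sylv p q) = rev_sign * \det (bez N p q).
Proof.
move=> sp sq; have [p0|] := eqVneq (p 0%N) 0; last exact: det_sylv_aux.
have [q0|q0] := eqVneq (q 0%N) 0.
  have bez0 : \det (bez N p q) = 0.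
    rewrite (expand_det_row _ ord0) big1 // => j _.
    by rewrite mxE bezf0 /cross p0 q0 !mul0r subrr mul0r.
  rewrite bez0 mulr0 (expand_det_col _ (lshift n ord0)) big1 // => i _.
  rewrite /sylv; rewrite -(splitK i); case: (split i) => k /=;
    rewrite ?col_mxEu ?col_mxEd !mxE /= leqn0;
    by case: eqP => [->|] /=; rewrite ?subn0 ?p0 ?q0 mul0r.
pose p' k := p k + q k.
have sp' : supported N p' by move=> k kN; rewrite /p' sp // sq // addr0.
have p'0 : p' 0%N != 0 by rewrite /p' p0 add0r.
have -> : bez N p q = bez N p' q.
  apply/matrixP => i j; rewrite !mxE; apply: eq_bigr => k _.
  by rewrite /cross /p'; ring.
rewrite -(det_sylv_aux sp' sq p'0).
have -> : sylv p' q = block_mx 1%:M 1%:M 0 1%:M *m sylv p q.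
  rewrite /sylv !sylv_rowsE -/(block_mx _ _ _ _) mulmx_block !mul1mx !mul0mx !add0r.
  congr block_mx; apply/matrixP => i j; rewrite !mxE /p'.
    by case: leqP => // _; rewrite addr0.
  by case: leqP => // _; rewrite addr0.
by rewrite det_mulmx det_ublock !det1 !mul1r.
Qed.

End Sylvester.

(** * Associated forms *)

Section AssociatedForm.
Variables (K : numFieldType) (N : nat).
Implicit Types (a p q : nat -> K) (f F u v w : {mpoly K[2]}).

(** The functional with value a m on x^(2N-m) y^m kills the products of p with the monomials of
    degree N - 1. *)
Definition annihilates a p := forall j, (j < N)%N -> \sum_(k < N.+2) a (j + k)%N * p k = 0.

Definition shift_rows p : 'M[K]_(N, (N + N).+1) :=
  \matrix_(i, j) if (i <= j)%N then p (j - i)%N else 0.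

Lemma shift_sum a p j : supported N p -> (j < N)%N ->
  \sum_(k < (N + N).+1) (if (j <= k)%N then p (k - j)%N else 0) * a k =
  \sum_(k < N.+2) a (j + k)%N * p k.
Proof.
move=> sp jN; rewrite (eq_bigr (fun k : 'I_(N + N).+1 => if (0 + j <= k)%N then p (k - j)%N * a k else 0)); last first.
  by move=> k _; rewrite add0n; case: leqP; rewrite ?mul0r.
rewrite -big_mkcond -(big_geq_mkord (0 + j)%N _ xpredT (fun k => p (k - j)%N * a k)).
rewrite big_addn big_mkord.
have le : (N.+2 <= (N + N).+1 - j)%N by lia.
rewrite (big_ord_widen _ (fun k => a (j + k)%N * p k) le) [RHS]big_mkcond.
apply: eq_bigr => k _ /=; rewrite addnK addnC mulrC.
by case: ltnP => // kN; rewrite sp ?mulr0.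
Qed.

Definition functional a w : K := \sum_(i < (N + N).+1) a i * bcoef (N + N) w i.

Lemma functionalD a w w' : functional a (w + w') = functional a w + functional a w'.
Proof.
rewrite /functional -big_split; apply: eq_bigr => i _.
by rewrite !bcoefE mcoeffD mulrDr.
Qed.

Lemma functionalZ a c w : functional a (c *: w) = c * functional a w.
Proof.
by rewrite mulr_sumr; apply: eq_bigr => i _; rewrite !bcoefE mcoeffZ mulrCA.
Qed.

Lemma functional_sum a (I : Type) (r : seq I) (c : I -> K) (Q : I -> {mpoly K[2]}) :
  functional a (\sum_(i <- r) c i *: Q i) = \sum_(i <- r) c i * functional a (Q i).
Proof.
elim: r => [|i r IH].
  by rewrite !big_nil; apply: big1 => i _; rewrite bcoefE mcoeff0 mulr0.
by rewrite !big_cons functionalD functionalZ IH.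
Qed.

Lemma bcoef_bmonM w j k : w \is N.+1.-homog -> (j < N)%N ->
  bcoef (N + N) ('X_[bmon N.-1 j] * w) k =
  if (j <= k)%N then bcoef N.+1 w (k - j)%N else 0.
Proof.
move=> hw jN; have -> : (N + N = N.-1 + N.+1)%N by lia.
rewrite bcoefM //; last by rewrite dhomogX /= mdeg_bmon //; lia.
have [jk|kj] := leqP j k.
  rewrite (bigD1 (Ordinal (jk : (j < k.+1)%N))) //= bcoefX eqxx mul1r big1 ?addr0 // => i.
  by rewrite -val_eqE /= bcoefX eq_sym => /negbTE ->; rewrite mul0r.
rewrite big1 // => i _; rewrite bcoefX; case: eqP => [ji|]; rewrite ?mul0r //.
by have := ltn_ord i; rewrite -ji ltnS leqNgt kj.
Qed.

Lemma functional_mul a u w : w \is N.+1.-homog -> annihilates a (bcoef N.+1 w) ->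
  functional a (u * w) = 0.
Proof.
move=> hw aw; rewrite (mpolyE u) mulr_suml.
under eq_bigr => m _ do rewrite -scalerAl.
rewrite functional_sum big1_seq // => m _.
have [dm|dm] := eqVneq (mdeg m + N.+1)%N (N + N)%N; last first.
  rewrite [functional _ _]big1 ?mulr0 // => i _.
  have hm : 'X_[m] * w \is (mdeg m + N.+1).-homog.
    by apply: dhomogM => //; rewrite dhomogX.
  by rewrite bcoefE (dhomog_nemf_coeff hm) ?mulr0 //= mdeg_bmon 1?eq_sym // -ltnS.
have jN : (m iy < N)%N by have := mdeg2 m; lia.
have -> : m = bmon N.-1 (m iy) by rewrite {1}(bmon_mdeg m); congr bmon; lia.
apply/eqP; rewrite mulf_eq0; apply/orP; right; apply/eqP.
rewrite -[RHS](aw _ jN) -shift_sum //; last by move=> k; apply: bcoef_gt.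
by apply: eq_bigr => k _; rewrite bcoef_bmonM // mulrC.
Qed.

Definition linear_form (z : 'I_2 -> K) : {mpoly K[2]} := z ix *: 'X_ix + z iy *: 'X_iy.

Lemma linear_form_pow m (z : 'I_2 -> K) :
  linear_form z ^+ m = form m (fun k => z ix ^+ (m - k) * z iy ^+ k).
Proof.
rewrite -[m in LHS](card_ord m) -prodr_const.
rewrite (eq_bigr (fun=> \sum_(c : 'I_2) z c *: 'X_c)); last by move=> i _; rewrite big_ord2.
rewrite (bigA_distr_bigA (fun (_ : 'I_m) (c : 'I_2) => z c *: ('X_c : {mpoly K[2]}))).
apply: eq_bigr => t _; rewrite scaler_prod; congr (_ *: _).
by rewrite (prod_wt t z) card_ord.
Qed.

Lemma form_eval m phi (z : 'I_2 -> K) : (form m phi).@[z] =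
  \sum_(k < m.+1) 'C(m, k)%:R * phi k * (z ix ^+ (m - k) * z iy ^+ k).
Proof.
rewrite {1}(homog_sum (form_homog m phi)) raddf_sum; apply: eq_bigr => k _.
by rewrite /= mevalZ mevalX big_prod2 bmon_iy bmon_ix bcoef_form.
Qed.

(** Macaulay duality: a functional in degree 2N and the form with normalised coefficients [a]
    determine each other through powers of linear forms. Hence the associated form comes from the
    functional that kills the Jacobian ideal and is 1 on the Hessian. *)
Lemma functional_pow a (z : 'I_2 -> K) :
  functional a (linear_form z ^+ (N + N)) = (form (N + N) a).@[z].
Proof.
rewrite form_eval linear_form_pow; apply: eq_bigr => k _.
by rewrite bcoef_form mulrCA mulrA.
Qed.

Variable f : {mpoly K[2]}.
Hypothesis hf : f \is N.+2.-homog.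

Local Notation fx := f^`M(ix).
Local Notation fy := f^`M(iy).
Local Notation p := (bcoef N.+1 fx).
Local Notation q := (bcoef N.+1 fy).

Lemma hfx : fx \is N.+1.-homog. Proof. exact: homog_deriv. Qed.
Lemma hfy : fy \is N.+1.-homog. Proof. exact: homog_deriv. Qed.

Lemma sp : supported N p. Proof. by move=> k; apply: bcoef_gt hfx. Qed.
Lemma sq : supported N q. Proof. by move=> k; apply: bcoef_gt hfy. Qed.

Definition grad_bez : 'M[K]_N.+1 := bez N p q.

Definition disc_const : K := (-1) ^+ 'C(N.+2, 2) / N.+2%:R ^+ N * rev_sign K N.

Lemma disc_const_neq0 : disc_const != 0.
Proof.
by rewrite !mulf_neq0 ?signr_eq0 ?rev_sign_neq0 // invr_neq0 // expf_neq0 // pnatr_eq0.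
Qed.

Lemma discriminantE : discriminant N.+2 f = disc_const * \det grad_bez.
Proof.
by rewrite /disc_const -[RHS]mulrA -(det_sylv sp sq) /discriminant !subSS subn0.
Qed.

Lemma bcoef_deriv_ixE m (g : {mpoly K[2]}) k : g \is m.+1.-homog ->
  bcoef m g^`M(ix) k = (m.+1%:R - k%:R) * bcoef m.+1 g k.
Proof.
move=> hg; have [km|mk] := leqP k m; first by rewrite bcoef_deriv_ix // natrB // leqW.
rewrite (bcoef_gt (homog_deriv _ hg)) //; have [->|] := eqVneq k m.+1.
  by rewrite subrr mul0r.
by move=> neq; rewrite (bcoef_gt hg) ?mulr0 // ltn_neqAle eq_sym neq.
Qed.

Lemma hessian_homog : hessian f \is (N + N).-homog.
Proof.
have h i j : f^`M(i)^`M(j) \is N.-homog by do 2!apply: homog_deriv.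
by rewrite /hessian expr2; apply: dhomogD; rewrite ?dhomogN; apply: dhomogM.
Qed.

Lemma bcoef_hessian m : bcoef (N + N) (hessian f) m =
  N.+1%:R * \sum_(i < m.+1) bezf p q i (m - i).
Proof.
have h i j : f^`M(i)^`M(j) \is N.-homog by do 2!apply: homog_deriv.
rewrite /hessian bcoefE mcoeffB -!bcoefE expr2 {2}(mderiv_comm ix iy f).
rewrite !bcoefM //.
(* Every sum is rewritten as weights times [F i]; the weights agree by (n - i)(s - i) - i(n - (s -
   i)) = n(s - 2i), with n = [N.+1] and s = [m.+1]. *)
pose F i := p i * q (m.+1 - i)%N.
have -> : \sum_(i < m.+1) bcoef N fx^`M(ix) i * bcoef N fy^`M(iy) (m - i) =
    \sum_(i < m.+2) (N.+1%:R - i%:R) * (m.+1 - i)%:R * F i.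
  rewrite [RHS]big_ord_recr /= subnn mulr0 mul0r addr0.
  apply: eq_bigr => i _; rewrite (bcoef_deriv_ixE _ hfx) bcoef_deriv_iy.
  by rewrite -subSn -1?ltnS // /F; ring.
have -> : \sum_(i < m.+1) bcoef N fx^`M(iy) i * bcoef N fy^`M(ix) (m - i) =
    \sum_(i < m.+2) i%:R * (N.+1%:R - (m.+1 - i)%:R) * F i.
  rewrite [RHS]big_ord_recl !mul0r add0r.
  apply: eq_bigr => i _; rewrite (bcoef_deriv_ixE _ hfy) bcoef_deriv_iy.
  by rewrite lift0 subSS /F subSS; ring.
have -> : \sum_(i < m.+1) bezf p q i (m - i) =
    \sum_(i < m.+2) (m.+1 - i)%:R * cross p q i (m.+1 - i).
  rewrite [RHS]big_ord_recr /= subnn mul0r addr0.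
  rewrite (eq_bigr (fun i : 'I_m.+1 => \sum_(j < m.+1) if (j <= i)%N then cross p q j (m.+1 - j) else 0)).
    rewrite exchange_big; apply: eq_bigr => j _ /=; rewrite -big_mkcond.
    rewrite -(big_geq_mkord j _ xpredT (fun=> cross p q j (m.+1 - j))) sumr_const_nat.
    by rewrite mulr_natl.
  move=> i _; rewrite /bezf (big_ord_widen _ (fun j => cross p q j (i + (m - i).+1 - j)) (ltn_ord i)).
  rewrite big_mkcond; apply: eq_bigr => j _; rewrite ltnS.
  by have := ltn_ord i; rewrite ltnS => im; rewrite addnS subnKC.
have -> : \sum_(i < m.+2) (m.+1 - i)%:R * cross p q i (m.+1 - i) =
    \sum_(i < m.+2) ((m.+1 - i)%:R - i%:R) * F i.
  under eq_bigr => i _ do rewrite /cross mulrBr.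
  rewrite sumrB [X in _ - X](reindex_inj rev_ord_inj) -sumrB; apply: eq_bigr => i _ /=.
  by rewrite subSS subKn -1?ltnS // /F; ring.
rewrite -sumrB mulr_sumr; apply: eq_bigr => i _; ring.
Qed.

Hypothesis N_gt0 : (0 < N)%N.
Hypothesis disc : discriminant N.+2 f != 0.

Lemma grad_bez_unit : grad_bez \in unitmx.
Proof. by move: disc; rewrite discriminantE mulf_eq0 negb_or unitmxE unitfE => /andP []. Qed.

Definition jacobian_rows : 'M[K]_(N + N, (N + N).+1) := col_mx (shift_rows p) (shift_rows q).

Lemma col_mulmx m n l (A : 'M[K]_(m, n)) (B : 'M[K]_(n, l)) j :
  col j (A *m B) = A *m col j B.
Proof. by rewrite !colE mulmxA. Qed.

Lemma annihilates_ker a : jacobian_rows *m colv (N + N) a = 0 <->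
  annihilates a p /\ annihilates a q.
Proof.
rewrite /jacobian_rows mul_col_mx.
have E p' : supported N p' -> shift_rows p' *m colv (N + N) a = 0 <-> annihilates a p'.
  move=> sp'; split=> [/colP H j jN|H].
    have := H (Ordinal jN); rewrite !mxE -shift_sum // => E; rewrite -[RHS]E.
    by apply: eq_bigr => k _; rewrite !mxE.
  apply/colP => j; rewrite !mxE -[RHS](H j) // -shift_sum //.
  by apply: eq_bigr => k _; rewrite !mxE.
rewrite -(E _ sp) -(E _ sq); split=> [|[-> ->]]; last exact: col_mx0.
by rewrite -[0](col_mx0) => /eq_col_mx.
Qed.

(** The degree 2N part of the Jacobian ideal is spanned by 2N products, in a space of dimension 2N +
    1. *)
Lemma annihilator_exists : exists2 a, annihilates a p /\ annihilates a q &
  exists i : 'I_(N + N).+1, a i != 0.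
Proof.
have : cokermx jacobian_rows != 0.
  by rewrite -mxrank_eq0 mxrank_coker subn_eq0 -ltnNge ltnS rank_leq_row.
case/matrix0Pn => i [j nz].
exists (fun m => cokermx jacobian_rows (inord m) j); last by exists i; rewrite inord_val.
apply/annihilates_ker; have := congr1 (col j) (mulmx_coker jacobian_rows).
rewrite col_mulmx linear0 => E; rewrite -[RHS]E; congr (_ *m _).
by apply/colP => k; rewrite !mxE inord_val.
Qed.

(** One factor [N.+1] comes from [bcoef_hessian], the other from the trace of [c%:M]. So the value
    is 1 exactly for c = [N.+1%:R ^- 2], the normalisation used below. *)
Lemma functional_hessian a c : hankel N a *m grad_bez = c%:M ->
  functional a (hessian f) = N.+1%:R ^+ 2 * c.
Proof.
move=> E; transitivity (N.+1%:R * \tr (hankel N a *m grad_bez)).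
  rewrite (trace_hankel_bez sp sq) mulr_sumr; apply: eq_bigr => m _.
  by rewrite bcoef_hessian mulrCA.
by rewrite E mxtrace_scalar -[c *+ _]mulr_natl expr2 mulrA.
Qed.

Lemma hankel_scalar a : annihilates a p -> annihilates a q ->
  exists c, hankel N a *m grad_bez = c%:M.
Proof. exact: (hankel_bez sp sq). Qed.

Lemma hankel_entry a (m : 'I_(N + N).+1) :
  a m = hankel N a (inord (minn m N)) (inord (m - minn m N)).
Proof.
rewrite mxE !inordK; last 2 first.
- by have := ltn_ord m; lia.
- by lia.
by congr a; lia.
Qed.

Lemma annihilator_scalar_neq0 a c : hankel N a *m grad_bez = c%:M ->
  (exists i : 'I_(N + N).+1, a i != 0) -> c != 0.
Proof.
move=> E [i ni]; move: ni; apply: contra_neq => c0; rewrite hankel_entry.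
have -> : hankel N a = 0.
  by rewrite -[hankel N a](mulmxK grad_bez_unit) E c0 -scalemx1 scale0r mul0mx.
by rewrite mxE.
Qed.

(** Both Hankel matrices are multiples of the inverse Bezoutian, and a Hankel matrix contains its
    whole sequence. This is the one-dimensionality of the socle. *)
Lemma annihilator_unique a c a' c' : hankel N a *m grad_bez = c%:M ->
  hankel N a' *m grad_bez = c'%:M -> c != 0 ->
  forall m : 'I_(N + N).+1, a' m = c' / c * a m.
Proof.
move=> E E' c0 m; rewrite !hankel_entry.
have -> : hankel N a' = (c' / c) *: hankel N a.
  rewrite -[LHS](mulmxK grad_bez_unit) -[hankel N a](mulmxK grad_bez_unit) E E'.
  by rewrite !mul_scalar_mx scalerA divfK.
by rewrite mxE.
Qed.

Lemma normalised_annihilator : exists a, [/\ annihilates a p, annihilates a q &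
  hankel N a *m grad_bez = (N.+1%:R ^- 2)%:M].
Proof.
have [a [ap aq] nz] := annihilator_exists.
have [c E] := hankel_scalar ap aq; have c0 := annihilator_scalar_neq0 E nz.
pose t : K := N.+1%:R ^- 2 / c.
exists (fun m => t * a m).
have ann p' : annihilates a p' -> annihilates (fun m => t * a m) p'.
  move=> ap' j jN; transitivity (t * \sum_(k < N.+2) a (j + k)%N * p' k).
    by rewrite mulr_sumr; apply: eq_bigr => k _; rewrite mulrA.
  by rewrite ap' ?mulr0.
split; [exact: ann | exact: ann |].
have -> : hankel N (fun m => t * a m) = t *: hankel N a by apply/matrixP => i j; rewrite !mxE.
by rewrite -scalemxAl E scale_scalar_mx /t divfK.
Qed.

(** Every annihilator of the ideal is a multiple of [a], so a form killed by [a] is killed by all of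
    them and lies in the row space of [jacobian_rows]; the combination of rows yields u and v. *)
Lemma ker_functional_ideal a c w : hankel N a *m grad_bez = c%:M -> c != 0 ->
  w \is (N + N).-homog -> functional a w = 0 ->
  exists u v : {mpoly K[2]}, w = u * fx + v * fy.
Proof.
move=> E c0 hw aw; pose r : 'rV[K]_(N + N).+1 := \row_k bcoef (N + N) w k.
have : (r <= jacobian_rows)%MS.
  rewrite submxE; apply/eqP/rowP => j; rewrite mxE [RHS]mxE.
  pose a' m : K := cokermx jacobian_rows (inord m) j.
  have [|ap' aq'] := (annihilates_ker a').1.
    have := congr1 (col j) (mulmx_coker jacobian_rows).
    rewrite col_mulmx linear0 => E'; rewrite -[RHS]E'; congr (_ *m _).
    by apply/colP => k; rewrite [LHS]mxE [RHS]mxE /a' inord_val.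
  have [c' E'] := hankel_scalar ap' aq'.
  transitivity (c' / c * functional a w); last by rewrite aw mulr0.
  rewrite mulr_sumr; apply: eq_bigr => k _.
  have := annihilator_unique E E' c0 k; rewrite {1}/a' inord_val => ->.
  by rewrite [r _ _]mxE mulrC mulrA.
case/submxP => D rD.
pose l (D' : 'rV[K]_N) : {mpoly K[2]} := \sum_(j < N) D' 0 j *: 'X_[bmon N.-1 j].
have coef_l D' g k : g \is N.+1.-homog -> (k <= N + N)%N ->
    bcoef (N + N) (l D' * g) k = (D' *m shift_rows (bcoef N.+1 g)) 0 (inord k).
  move=> hg kN; rewrite mulr_suml bcoefE raddf_sum mxE; apply: eq_bigr => j _ /=.
  by rewrite -scalerAl mcoeffZ -bcoefE bcoef_bmonM // mxE inordK.
have hom_l D' : l D' \is N.-1.-homog.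
  apply: rpred_sum => j _; apply: dhomogZ; rewrite dhomogX /= mdeg_bmon //.
  by have := ltn_ord j; lia.
have hom g D' : g \is N.+1.-homog -> l D' * g \is (N + N).-homog.
  by move=> hg; have -> : (N + N = N.-1 + N.+1)%N by [lia|]; apply: dhomogM.
exists (l (lsubmx D)), (l (rsubmx D)); apply: homog_eq hw _ _.
  by apply: dhomogD; apply: hom; [exact: hfx | exact: hfy].
move=> k kN; rewrite [RHS]bcoefE mcoeffD -!bcoefE !coef_l //; [|exact: hfy|exact: hfx].
have /rowP /(_ (inord k)) := rD; rewrite mxE inordK // => ->.
by rewrite -[D in LHS]hsubmxK mul_row_col [LHS]mxE.
Qed.

(** Applying the functional to the defining relation forces F(z) to be its value on (z1 x + z2
    y)^(2N). Conversely, for this F the difference of the two sides is killed by the functional,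
    hence lies in the ideal. *)
Lemma is_associated_formE a F : annihilates a p -> annihilates a q ->
    hankel N a *m grad_bez = (N.+1%:R ^- 2)%:M ->
  is_associated_form N.+2 f F <-> F = form (N + N) a.
Proof.
move=> ap aq E; have n0 : N.+1%:R != 0 :> K by rewrite pnatr_eq0.
have hess1 : functional a (hessian f) = 1.
  by rewrite (functional_hessian E) divff // expf_neq0.
have dE : (2 * (N.+2 - 2) = N + N)%N by lia.
rewrite /is_associated_form dE; split=> [[hF rel]|->].
  apply: (homog_eq hF (form_homog _ _)) => k kN.
  have Ed : dehom (N + N) F = dehom (N + N) (form (N + N) a).
    apply/eqP; rewrite -subr_eq0; apply/eqP; apply: poly_eq0_of_values => t.
    rewrite hornerD hornerN !dehom_eval ?form_homog //; apply/eqP; rewrite subr_eq0; apply/eqP.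
    have [u [v uv]] := rel (fun i => pt t i 0); rewrite -functional_pow.
    have -> : linear_form (fun i => pt t i 0) ^+ (N + N) =
        u * fx + v * fy + F.@[fun i => pt t i 0] *: hessian f by rewrite -uv subrK.
    rewrite !functionalD functionalZ hess1 mulr1 !functional_mul ?add0r //.
      exact: hfy.
    exact: hfx.
  by rewrite -!coef_dehom ?form_homog // Ed.
split=> [|z]; first exact: form_homog.
have c0 : N.+1%:R ^- 2 != 0 :> K by rewrite invr_neq0 // expf_neq0.
apply: (ker_functional_ideal E c0).
  rewrite -/(linear_form z) linear_form_pow rpredB ?form_homog //.
  by apply: dhomogZ; exact: hessian_homog.
by rewrite -scaleNr functionalD functionalZ functional_pow hess1 mulr1 subrr.
Qed.

Lemma associated_formE a : annihilates a p -> annihilates a q ->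
    hankel N a *m grad_bez = (N.+1%:R ^- 2)%:M ->
  associated_form N.+2 f = form (N + N) a.
Proof.
move=> ap aq E; apply/(is_associated_formE _ ap aq E).
apply: (@classical_sets.xgetPex _ 0 (is_associated_form N.+2 f)).
by exists (form (N + N) a); apply/(is_associated_formE _ ap aq E).
Qed.

Lemma associated_form_homog : associated_form N.+2 f \is (N + N).-homog.
Proof.
have [a [ap aq E]] := normalised_annihilator.
rewrite (associated_formE ap aq E).
exact: form_homog.
Qed.

Lemma hankel_associated_form :
  hankel N (ncoef (N + N) (associated_form N.+2 f)) *m grad_bez = (N.+1%:R ^- 2)%:M.
Proof.
have [a [ap aq E]] := normalised_annihilator.
rewrite (associated_formE ap aq E).
rewrite -[RHS]E; congr (_ *m _); apply/matrixP => i j; rewrite !mxE ncoef_form //.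
by have := ltn_ord i; have := ltn_ord j; lia.
Qed.

End AssociatedForm.

(** * Covariance *)

Section Vanishing.
Variable K : numFieldType.

Lemma mpoly_eq0_of_values n (p : {mpoly K[n]}) : (forall v, p.@[v] = 0) -> p = 0.
Proof.
elim: n p => [|n IH] p p0.
  apply/mpolyP => m; rewrite mcoeff0; have -> : m = 0%MM by apply/mnmP; case.
  rewrite -(p0 (fun=> 0)) mevalE.
  have supp m' : m' \in msupp p -> m' = 0%MM by move=> _; apply/mnmP; case.
  have [z|nz] := boolP (0%MM \in msupp p); last first.
    rewrite (memN_msupp_eq0 nz) big1_seq // => m' /andP [_ m'p].
    by have e := supp _ m'p; move: m'p; rewrite e (negbTE nz).
  rewrite (bigD1_seq 0%MM) //= big_ord0 mulr1 big1_seq ?addr0 //.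
  by move=> m' /andP [n0 /supp m'0]; rewrite m'0 eqxx in n0.
pose widen := @widen_ord n n.+1 (leqnSn n).
pose rst (m : 'X_{1.. n.+1}) : 'X_{1.. n} := [multinom m (widen i) | i < n].
have evalE (v' : 'I_n -> K) t : (map_poly (meval v') (muni p)).[t] = 0.
  pose v (i : 'I_n.+1) := if (insub (val i) : option 'I_n) is Some j then v' j else t.
  have vw j : v (widen j) = v' j by rewrite /v /= valK.
  have vm : v ord_max = t by rewrite /v insubF //= ltnn.
  rewrite -(p0 v) mevalE muniE rmorph_sum horner_sum; apply: eq_bigr => m _.
  rewrite /= map_polyZ map_polyXn hornerZ hornerXn /= mevalZ mevalX -mulrA; congr (_ * _).
  rewrite big_ord_recr /= vm; congr (_ * _); apply: eq_bigr => j _.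
  by rewrite mnmE vw.
have muni0 : muni p = 0.
  apply/polyP => j; rewrite coef0; apply: IH => v'.
  have := congr1 (fun q : {poly K} => q`_j) (poly_eq0_of_values (evalE v')).
  by rewrite coef_map coef0.
apply/mpolyP => m; rewrite mcoeff0.
have [mp|mp] := boolP (m \in msupp p); last exact: memN_msupp_eq0.
have := congr1 (fun q : {poly {mpoly K[n]}} => q`_(m ord_max)@_(rst m)) muni0.
rewrite muniE coef_sum raddf_sum coef0 mcoeff0 (bigD1_seq m) //=.
rewrite coefZ coefXn eqxx mulr1 mcoeffZ mcoeffX eqxx mulr1 big1 ?addr0 // => m' neq.
rewrite coefZ coefXn; case: eqP => [E|_]; last by rewrite mulr0 mcoeff0.
rewrite mulr1 mcoeffZ mcoeffX; case: eqP => [E'|_]; last by rewrite mulr0.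
case/eqP: neq; apply/mnmP => i; have [in_|ni] := ltnP i n.
  have -> : i = widen (Ordinal in_) by apply: val_inj.
  by have := congr1 (fun m0 : 'X_{1.. n} => m0 (Ordinal in_)) E'; rewrite !mnmE.
have -> : i = ord_max by apply: val_inj; apply/eqP; rewrite /= eqn_leq ni -ltnS ltn_ord.
by rewrite E.
Qed.

End Vanishing.

(** * Contractions under linear substitution *)

Section ContractTensor.
Variables (K : numFieldType) (I : finType).

Lemma bw_le n (s : {ffun I * 'I_n -> 'I_2}) i : (bw s i <= n)%N.
Proof.
rewrite -[leqRHS](card_ord n) -sum1_card; apply: leq_sum => j _.
by rewrite -ltnS.
Qed.

Lemma eq_contract n (sigma : {perm I * 'I_n}) (D D' : nat -> nat -> K) :
  (forall k l, (k <= n)%N -> (l <= n)%N -> D k l = D' k l) ->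
  contract sigma D = contract sigma D'.
Proof.
move=> E; apply: eq_bigr => s _; apply: eq_bigr => t _; congr (_ * _).
by apply: eq_bigr => i _; rewrite E ?bw_le.
Qed.

Lemma contract_scale n (sigma : {perm I * 'I_n}) c (D : nat -> nat -> K) :
  contract sigma (fun k l => c * D k l) = c ^+ #|I| * contract sigma D.
Proof.
rewrite /contract mulr_sumr; apply: eq_bigr => s _.
rewrite mulr_sumr; apply: eq_bigr => t _.
by rewrite big_split prodr_const /= mulrCA.
Qed.

Lemma eps_det (M : 'M[K]_2) i j :
  \sum_(b : 'I_2) \sum_(c : 'I_2) eps K b c * (M b i * M c j) = \det M * eps K i j.
Proof.
rewrite !big_ord2 det2E /eps.
by case: (ord2E i) => ->; case: (ord2E j) => -> /=; ring.
Qed.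

Lemma big_uncurry (J C : finType) (G : I -> {ffun J -> C} -> K) :
  \prod_i \sum_s G i s = \sum_(S : {ffun I * J -> C}) \prod_i G i [ffun j => S (i, j)].
Proof.
rewrite bigA_distr_bigA.
pose h (S : {ffun I * J -> C}) : {ffun I -> {ffun J -> C}} :=
  [ffun i => [ffun j => S (i, j)]].
have hb : bijective h.
  exists (fun f : {ffun I -> {ffun J -> C}} => [ffun a => f a.1 a.2]).
    by move=> S; apply/ffunP => -[i j]; rewrite !ffunE.
  by move=> f; apply/ffunP => i; apply/ffunP => j; rewrite !ffunE.
rewrite (reindex h (onW_bij _ hb)); apply: eq_bigr => S _.
by apply: eq_bigr => i _; rewrite ffunE.
Qed.

(** Each bracket contributes one factor [\det M] ([eps_det]), and there is one bracket for each
    element of [I * 'I_n]. *)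
Lemma contract_tensor n (sigma : {perm I * 'I_n}) M (D D' : nat -> nat -> K) :
    (forall k l, (k <= n)%N -> (l <= n)%N -> D' k l =
       sact n M (fun k' => sact n M (D k') l) k) ->
  contract sigma D' = \det M ^+ #|{: I * 'I_n}| * contract sigma D.
Proof.
move=> DD'; pose mon (s s' : {ffun I * 'I_n -> 'I_2}) := \prod_a M (s a) (s' a).
have expand (s t : {ffun I * 'I_n -> 'I_2}) : \prod_i D' (bw s i) (bw t i) =
    \sum_(s' : {ffun I * 'I_n -> 'I_2}) \sum_(t' : {ffun I * 'I_n -> 'I_2})
      mon s s' * mon t t' * \prod_i D (bw s' i) (bw t' i).
  have wtE (u : {ffun I * 'I_n -> 'I_2}) i : wt [ffun j => u (i, j)] = bw u i.
    by apply: eq_bigr => j _; rewrite ffunE.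
  have tens (u : {ffun I * 'I_n -> 'I_2}) i (a : nat -> K) : sact n M a (bw u i) =
      \sum_(u' : {ffun 'I_n -> 'I_2}) (\prod_j M (u (i, j)) (u' j)) * a (wt u').
    rewrite -wtE; have := sact_tensor M a [ffun j => u (i, j)].
    rewrite card_ord => <-; apply: eq_bigr => u' _; congr (_ * _).
    by apply: eq_bigr => j _; rewrite ffunE.
  transitivity (\prod_i \sum_(s' : {ffun 'I_n -> 'I_2}) \sum_(t' : {ffun 'I_n -> 'I_2})
      (\prod_j M (s (i, j)) (s' j)) * (\prod_j M (t (i, j)) (t' j)) * D (wt s') (wt t')).
    apply: eq_bigr => i _; rewrite DD' ?bw_le // tens; apply: eq_bigr => s' _.
    by rewrite tens mulr_sumr; apply: eq_bigr => t' _; rewrite mulrA.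
  rewrite big_uncurry; apply: eq_bigr => s' _.
  rewrite big_uncurry; apply: eq_bigr => t' _.
  rewrite !big_split /= /mon; congr (_ * _ * _); last 1 first.
  - by apply: eq_bigr => i _; rewrite !wtE.
  - rewrite [RHS](eq_bigr (fun a => M (s (a.1, a.2)) (s' (a.1, a.2)))); last by case.
    rewrite -(pair_bigA _ (fun i j => M (s (i, j)) (s' (i, j)))).
    by apply: eq_bigr => i _; apply: eq_bigr => j _; rewrite ffunE.
  - rewrite [RHS](eq_bigr (fun a => M (t (a.1, a.2)) (t' (a.1, a.2)))); last by case.
    rewrite -(pair_bigA _ (fun i j => M (t (i, j)) (t' (i, j)))).
    by apply: eq_bigr => i _; apply: eq_bigr => j _; rewrite ffunE.
transitivity (\sum_(s' : {ffun I * 'I_n -> 'I_2}) \sum_(t' : {ffun I * 'I_n -> 'I_2})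
    (\sum_(s : {ffun I * 'I_n -> 'I_2}) \sum_(t : {ffun I * 'I_n -> 'I_2})
       (\prod_a eps K (s a) (t (sigma a))) * (mon s s' * mon t t')) *
    \prod_i D (bw s' i) (bw t' i)).
  rewrite /contract; under eq_bigr => s _ do under eq_bigr => t _ do rewrite expand mulr_sumr.
  under eq_bigr => s _ do rewrite exchange_big.
  rewrite exchange_big; apply: eq_bigr => s' _.
  under eq_bigr => s _ do under eq_bigr => t _ do rewrite mulr_sumr.
  under eq_bigr => s _ do rewrite exchange_big.
  rewrite exchange_big; apply: eq_bigr => t' _.
  rewrite mulr_suml; apply: eq_bigr => s _.
  rewrite mulr_suml; apply: eq_bigr => t _.
  by rewrite mulrA.
rewrite /contract mulr_sumr; apply: eq_bigr => s' _.
rewrite mulr_sumr; apply: eq_bigr => t' _; rewrite mulrA; congr (_ * _).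
transitivity (\prod_a \sum_(b : 'I_2) \sum_(c : 'I_2)
    eps K b c * (M b (s' a) * M c (t' (sigma a)))); last first.
  by under eq_bigr => a _ do rewrite eps_det; rewrite big_split prodr_const.
rewrite (bigA_distr_bigA (fun a b => \sum_(c : 'I_2)
    eps K b c * (M b (s' a) * M c (t' (sigma a))))).
apply: eq_bigr => s _.
rewrite (bigA_distr_bigA (fun a c => eps K (s a) c * (M (s a) (s' a) * M c (t' (sigma a))))).
rewrite [RHS](big_ffun_perm sigma); apply: eq_bigr => t _.
rewrite /mon [X in _ * (_ * X)](reindex_perm sigma) -!big_split; apply: eq_bigr => a _.
by rewrite ffunE.
Qed.

End ContractTensor.

(** * Covariance of the Bezoutian, the discriminant and the Hankel matrix *)

Section Covariance.
Variables (K : numFieldType) (N : nat).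
Implicit Types (B : 'M[K]_N.+1) (M : 'M[K]_2) (phi : nat -> K) (f F : {mpoly K[2]}).

(** The normalised coefficients of the form of bidegree (N+1, N+1) with matrix [wedge_mx B]. The
    factor [N.+2%:R ^+ 2] undoes the two differentiations, so that [grad_bez] gives [wedge] on the
    nose. *)
Definition tens B k l : K := wedge_mx B (inord k) (inord l) /
  (N.+2%:R ^+ 2 * 'C(N.+1, k)%:R * 'C(N.+1, l)%:R).

Let den_neq0 k l : (k <= N.+1)%N -> (l <= N.+1)%N ->
  N.+2%:R ^+ 2 * 'C(N.+1, k)%:R * 'C(N.+1, l)%:R != 0 :> K.
Proof. by move=> kn ln; rewrite !mulf_neq0 ?bin_neq0 ?pnatr_eq0. Qed.

Lemma tens_scale c B k l : tens (c *: B) k l = c * tens B k l.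
Proof. by rewrite /tens wedge_mx_scale mxE mulrA. Qed.

Lemma tens_inj B B' :
  (forall k l, (k <= N.+1)%N -> (l <= N.+1)%N -> tens B k l = tens B' k l) -> B = B'.
Proof.
move=> E; apply: wedge_mx_inj; apply/matrixP => i j.
have iN : (i <= N.+1)%N by rewrite -ltnS. have jN : (j <= N.+1)%N by rewrite -ltnS.
have := E i j iN jN; rewrite /tens !inord_val => /(mulIf (_ : _^-1 != 0)); apply.
by rewrite invr_neq0 // den_neq0.
Qed.

Lemma tens_grad_bez f k l : f \is N.+2.-homog -> (k <= N.+1)%N -> (l <= N.+1)%N ->
  tens (grad_bez N f) k l = wedge (ncoef N.+2 f) k l.
Proof.
move=> hf kn ln; rewrite /tens (wedge_mx_bez (sp hf) (sq hf)) mxE !inordK //.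
rewrite /cross !bcoef_grad_ix // !bcoef_grad_iy // /wedge.
have a0 := den_neq0 kn ln; apply: (mulIf a0); rewrite divfK //; ring.
Qed.

Lemma eq_sact n M a a' k : (k <= n)%N -> (forall j, (j <= n)%N -> a j = a' j) ->
  sact n M a k = sact n M a' k.
Proof.
move=> kn E; rewrite -[k]/(nat_of_ord (Ordinal (kn : (k < n.+1)%N))) !sactE.
by apply: eq_bigr => j _; rewrite E // -ltnS.
Qed.

(** Passing to normalised coefficients transposes the matrix, by [symM_tr]; the factor [\det M] is
    that of [wedge_mx_symM]. *)
Lemma tens_symM B M k l : (k <= N.+1)%N -> (l <= N.+1)%N ->
  \det M * tens ((symM N M)^T *m B *m symM N M) k l =
  sact N.+1 M^T (fun k' => sact N.+1 M^T (tens B k') l) k.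
Proof.
move=> kn ln; have inE m (mn : (m <= N.+1)%N) : m = (inord m : 'I_N.+2) by rewrite inordK.
rewrite [in RHS](inE k kn) [in RHS](inE l ln) sactE.
under [RHS]eq_bigr => a _ do rewrite sactE mulr_sumr.
rewrite /tens mulrA.
have := congr1 (fun A : 'M_N.+2 => A (inord k) (inord l)) (wedge_mx_symM B M).
rewrite /= mxE => ->; rewrite mxE mulr_suml.
under [LHS]eq_bigr => b _ do rewrite [X in X * _ / _]mxE !mulr_suml.
rewrite exchange_big; apply: eq_bigr => a _; apply: eq_bigr => b _.
rewrite [(symM N.+1 M)^T _ _]mxE !inord_val.
have an : (a <= N.+1)%N by rewrite -ltnS. have bn : (b <= N.+1)%N by rewrite -ltnS.
have Ea := symM_tr M a (inord k); have Eb := symM_tr M b (inord l).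
rewrite -(inE k kn) in Ea; rewrite -(inE l ln) in Eb.
have Ca := bin_neq0 K an; have Cb := bin_neq0 K bn.
have Ck := bin_neq0 K kn; have Cl := bin_neq0 K ln.
have d0 : N.+2%:R != 0 :> K by rewrite pnatr_eq0.
have -> : symM N.+1 M a (inord k) = symM N.+1 M^T (inord k) a * 'C(N.+1, k)%:R / 'C(N.+1, a)%:R.
  by rewrite -Ea mulrAC mulfV ?mul1r.
have -> : symM N.+1 M b (inord l) = symM N.+1 M^T (inord l) b * 'C(N.+1, l)%:R / 'C(N.+1, b)%:R.
  by rewrite -Eb mulrAC mulfV ?mul1r.
move: (symM _ _ _ _) (symM _ _ _ _) (wedge_mx _ _ _) Ca Cb Ck Cl d0.
move: ('C(_, a)%:R) ('C(_, b)%:R) ('C(_, k)%:R) ('C(_, l)%:R) (N.+2%:R) => ca cb ck cl c x y z *.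
by field; do ?[apply/andP; split].
Qed.

(** Splitting degree [N.+2] as 1 + [N.+1], the split-off index replaces [X0] and [X1] by their
    combinations with matrix [M], and a wedge of two vectors is then multiplied by the
    determinant. *)
Lemma wedge_sact M phi k l : (k <= N.+1)%N -> (l <= N.+1)%N ->
  wedge (sact N.+2 M phi) k l =
  \det M * sact N.+1 M (fun k' => sact N.+1 M (wedge phi k') l) k.
Proof.
move=> kn ln.
pose X0 k := sact N.+1 M phi k; pose X1 k := sact N.+1 M (fun j => phi j.+1) k.
have inE m (mn : (m <= N.+1)%N) : m = (inord m : 'I_N.+2) by rewrite inordK.
have rowp1 c c' : (rowp M 1 (c : 'I_2))`_(c' : 'I_2) = M c c'.
  rewrite /rowp; case: (ord2E c) => -> /=; rewrite ?expr0 ?expr1 ?mulr1 ?mul1r /lin.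
    by rewrite coefD coefC coefZ coefX; case: (ord2E c') => -> /=; ring.
  by rewrite coefD coefC coefZ coefX; case: (ord2E c') => -> /=; ring.
have split (c : 'I_2) m : (m <= N.+1)%N ->
    sact N.+2 M phi (c + m) = M c ix * X0 m + M c iy * X1 m.
  move=> mn; rewrite (sact_split (m := 1) M phi _ mn); last by rewrite -ltnS.
  rewrite big_ord2 !rowp1 /X0 /X1 (inE m mn) !sactE !mulr_sumr.
  by congr (_ + _); apply: eq_bigr => j _; rewrite !mxE mulrA.
have W : sact N.+1 M (fun k' => sact N.+1 M (wedge phi k') l) k = X0 k * X1 l - X1 k * X0 l.
  rewrite /X0 /X1 (inE k kn) (inE l ln) !sactE !big_distrlr /= -sumrB.
  apply: eq_bigr => a _; rewrite sactE -sumrB mulr_sumr; apply: eq_bigr => b _.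
  by rewrite /wedge; ring.
have s0 m : (m <= N.+1)%N -> sact N.+2 M phi m = M ix ix * X0 m + M ix iy * X1 m := split ix m.
have s1 m : (m <= N.+1)%N -> sact N.+2 M phi m.+1 = M iy ix * X0 m + M iy iy * X1 m := split iy m.
rewrite W /wedge !s1 // !s0 // det2E; ring.
Qed.

(** One factor [\det M] comes from the gradient ([wedge_sact]), the other from the division by the
    bracket ([tens_symM]). *)
Lemma grad_bez_subst M f : f \is N.+2.-homog ->
  grad_bez N (row_subst M f) =
  \det M ^+ 2 *: ((symM N M^T)^T *m grad_bez N f *m symM N M^T).
Proof.
move=> hf; have hMf := row_subst_homog M hf.
apply: tens_inj => k l kn ln; rewrite tens_grad_bez // tens_scale expr2 -mulrA.
rewrite -[X in _ * (X * _)]det_tr tens_symM // trmxK.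
transitivity (wedge (sact N.+2 M (ncoef N.+2 f)) k l).
  by rewrite /wedge !ncoef_row_subst // ltnW.
rewrite wedge_sact //; congr (_ * _).
apply: eq_sact => // a an; apply: eq_sact => // b bn.
by rewrite tens_grad_bez.
Qed.

Lemma discriminant_subst M f : f \is N.+2.-homog -> M \in unitmx ->
  discriminant N.+2 (row_subst M f) = \det M ^+ (N.+1 * N.+2) * discriminant N.+2 f.
Proof.
move=> hf uM; rewrite !discriminantE ?row_subst_homog // grad_bez_subst // detZ.
have := symM_det N (M := M^T); rewrite unitmx_tr det_tr => /(_ uM) E.
have -> : (N.+1 * N.+2 = 2 * N.+1 + N * N.+1)%N by lia.
rewrite !det_mulmx det_tr exprD exprM -E; ring.
Qed.

Lemma hankel_subst g F : F \is (N + N).-homog ->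
  hankel N (ncoef (N + N) (row_subst g F)) =
  symM N g *m hankel N (ncoef (N + N) F) *m (symM N g)^T.
Proof.
move=> hF; apply/matrixP => i j; rewrite [LHS]mxE.
have iN : (i <= N)%N by rewrite -ltnS. have jN : (j <= N)%N by rewrite -ltnS.
rewrite ncoef_row_subst //; last by apply: leq_add.
rewrite sact_split // exchange_big mxE; apply: eq_bigr => l _.
rewrite mxE mulr_suml; apply: eq_bigr => k _.
by rewrite !mxE mulrAC.
Qed.

End Covariance.

(** * Lifting invariants *)

Section PolynomialFunctions.
Variables (K : numFieldType) (n : nat).
Implicit Types (phi psi : {mpoly K[2]} -> K).

Definition poly_fun phi := exists P : {mpoly K[n.+1]},
  forall f, phi f = P.@[fun i : 'I_n.+1 => bcoef n f i].

Lemma poly_fun_cst c : poly_fun (fun=> c).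
Proof. by exists c%:MP => f; rewrite mevalC. Qed.

Lemma poly_fun_bcoef k : (k <= n)%N -> poly_fun (fun f => bcoef n f k).
Proof. by move=> kn; exists 'X_(Ordinal (kn : (k < n.+1)%N)) => f; rewrite mevalXU. Qed.

Lemma poly_fun_mul phi psi : poly_fun phi -> poly_fun psi ->
  poly_fun (fun f => phi f * psi f).
Proof. by move=> [P HP] [Q HQ]; exists (P * Q) => f; rewrite HP HQ mevalM. Qed.

Lemma poly_fun_sum (I : Type) (r : seq I) (phi : I -> {mpoly K[2]} -> K) :
  (forall i, poly_fun (phi i)) -> poly_fun (fun f => \sum_(i <- r) phi i f).
Proof.
move=> Hphi; elim: r => [|i r [P HP]]; first by exists 0 => f; rewrite big_nil meval0.
have [Q HQ] := Hphi i; exists (Q + P) => f.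
by rewrite big_cons mevalD HP HQ.
Qed.

Lemma poly_fun_prod (I : Type) (r : seq I) (phi : I -> {mpoly K[2]} -> K) :
  (forall i, poly_fun (phi i)) -> poly_fun (fun f => \prod_(i <- r) phi i f).
Proof.
move=> Hphi; elim: r => [|i r [P HP]]; first by exists 1 => f; rewrite big_nil meval1.
have [Q HQ] := Hphi i; exists (Q * P) => f.
by rewrite big_cons mevalM HP HQ.
Qed.

Lemma poly_fun_exp phi k : poly_fun phi -> poly_fun (fun f => phi f ^+ k).
Proof. by move=> [P HP]; exists (P ^+ k) => f; rewrite rmorphXn /= HP. Qed.

Definition poly_mx m l (A : {mpoly K[2]} -> 'M[K]_(m, l)) :=
  forall i j, poly_fun (fun f => A f i j).

Lemma poly_fun_det m (A : {mpoly K[2]} -> 'M[K]_m) : poly_mx A ->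
  poly_fun (fun f => \det (A f)).
Proof.
move=> pA; apply: poly_fun_sum => s; apply: poly_fun_mul; first exact: poly_fun_cst.
by apply: poly_fun_prod => i; apply: pA.
Qed.

Lemma poly_mx_adj m (A : {mpoly K[2]} -> 'M[K]_m) : poly_mx A ->
  poly_mx (fun f => \adj (A f)).
Proof.
move=> pA i j.
have [P HP] : poly_fun (fun f => cofactor (A f) j i).
  apply: poly_fun_mul; first exact: poly_fun_cst.
  apply: poly_fun_det => k l.
  have [P HP] := pA (lift j k) (lift i l).
  by exists P => f; rewrite -HP !mxE.
by exists P => f; rewrite -HP mxE.
Qed.

Lemma poly_mx_cst m l (A : 'M[K]_(m, l)) : poly_mx (fun=> A).
Proof. by move=> i j; apply: poly_fun_cst. Qed.

Lemma poly_mx_mul m l o (A : {mpoly K[2]} -> 'M[K]_(m, l)) (B : {mpoly K[2]} -> 'M[K]_(l, o)) :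
  poly_mx A -> poly_mx B -> poly_mx (fun f => A f *m B f).
Proof.
move=> pA pB i j.
have [P HP] : poly_fun (fun f => \sum_k A f i k * B f k j).
  by apply: poly_fun_sum => k; apply: poly_fun_mul; [apply: pA | apply: pB].
by exists P => f; rewrite -HP mxE.
Qed.

Lemma poly_fun_tens N (A : {mpoly K[2]} -> 'M[K]_N.+1) k l : poly_mx A ->
  poly_fun (fun f => tens (A f) k l).
Proof.
move=> pA; apply: poly_fun_mul; last exact: poly_fun_cst.
have cst := poly_mx_cst.
have [P HP] := poly_mx_mul (poly_mx_mul (cst _ _ (mulx K N)^T) pA) (cst _ _ (muly K N))
  (inord k) (inord l).
have [Q HQ] := poly_mx_mul (poly_mx_mul (cst _ _ (muly K N)^T) pA) (cst _ _ (mulx K N))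
  (inord k) (inord l).
by exists (P - Q) => f; rewrite mevalB -HP -HQ !mxE.
Qed.

Lemma poly_fun_contract (I : finType) m (sigma : {perm I * 'I_m})
    (D : {mpoly K[2]} -> nat -> nat -> K) :
  (forall k l, poly_fun (fun f => D f k l)) -> poly_fun (fun f => contract sigma (D f)).
Proof.
move=> pD; apply: poly_fun_sum => s; apply: poly_fun_sum => t; apply: poly_fun_mul.
  exact: poly_fun_cst.
by apply: poly_fun_prod => i; apply: pD.
Qed.

Lemma poly_mx_hankel N : n = (N + N)%N -> poly_mx (fun F => hankel N (ncoef n F)).
Proof.
move=> nE i j; have [P HP] : poly_fun (fun F => bcoef n F (i + j)%N / 'C(n, i + j)%:R).
  apply: poly_fun_mul; last exact: poly_fun_cst.
  by apply: poly_fun_bcoef; have := ltn_ord i; have := ltn_ord j; lia.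
by exists P => F; rewrite -HP mxE.
Qed.

End PolynomialFunctions.

(** * Construction of J and its properties *)

Section Main.
Variables (K : numFieldType) (N : nat).
Hypothesis N_gt0 : (0 < N)%N.

Lemma eval_mmap m l (h : 'I_m -> {mpoly K[l]}) (P : {mpoly K[m]}) v :
  (mmap (@mpolyC _ _) h P).@[v] = P.@[fun i => (h i).@[v]].
Proof.
rewrite /mmap raddf_sum mevalE; apply: eq_bigr => k _ /=.
rewrite mevalM mevalC; congr (_ * _); rewrite /mmap1 rmorph_prod.
by apply: eq_bigr => i _; rewrite /= rmorphXn.
Qed.

Lemma apolar_covariant (f : {mpoly K[2]}) (P : {mpoly K[N.+3]}) w c : f \is N.+2.-homog ->
    (forall M, M \in unitmx ->
      P.@[fun i : 'I_N.+3 => bcoef N.+2 (row_subst M f) i] = \det M ^+ w * c) ->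
  apolar w (mmap (@mpolyC _ _) (fun i : 'I_N.+3 => gen_coef N.+2 (ncoef N.+2 f) i) P) =
  w.+1%:R * c.
Proof.
move=> hf cov; set Q := mmap _ _ _.
pose g := gen K ix ix * gen K iy iy - gen K ix iy * gen K iy ix.
have gE M : g.@[fun i => mxvec M 0 i] = \det M.
  by rewrite mevalB !mevalM !mevalXU !mxvecE det2E.
have g0 : g != 0.
  apply/eqP => gz; have := gE 1%:M; rewrite gz meval0 det1.
  by move/eqP; rewrite eq_sym oner_eq0.
have -> : Q = c *: g ^+ w.
  (* The identity is known at invertible matrices only; multiplied by the determinant [g] it holds
     at every matrix, and [g] cancels. *)
  apply/eqP; rewrite -subr_eq0; apply/eqP; apply: (mulIf g0); rewrite mul0r.
  apply: mpoly_eq0_of_values => v.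
  pose M : 'M[K]_2 := vec_mx (\row_k v k).
  have vE : v =1 fun i => mxvec M 0 i by move=> i; rewrite vec_mxK mxE.
  rewrite (meval_eq _ vE) mevalM mevalB mevalZ rmorphXn /= gE.
  have [uM|] := boolP (M \in unitmx); last first.
    by rewrite unitmxE unitfE negbK => /eqP ->; rewrite mulr0.
  rewrite eval_mmap; have -> : P.@[fun i : 'I_N.+3 =>
      (gen_coef N.+2 (ncoef N.+2 f) i).@[fun i0 => mxvec M 0 i0]] = \det M ^+ w * c.
    rewrite -cov //; apply: meval_eq => i.
    by rewrite gen_coef_eval -homog_form.
  by rewrite [\det M ^+ w * c]mulrC subrr mul0r.
have -> : c *: g ^+ w = \sum_(i <- [:: tt]) c *: g ^+ w by rewrite big_seq1.
by rewrite apolar_sum big_seq1 apolar_det mulrC.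
Qed.

Definition cat_mx (F : {mpoly K[2]}) : 'M[K]_N.+1 := hankel N (ncoef (N + N) F).

Lemma catalecticantE F : catalecticant N F = \det (cat_mx F).
Proof. by rewrite /catalecticant mul2n -addnn. Qed.

Lemma associated_form_cat (f : {mpoly K[2]}) : forms_disc N.+2 f -> forms_cat N (associated_form N.+2 f).
Proof.
case=> hf disc; split.
  by rewrite mul2n -addnn; apply: associated_form_homog.
have := congr1 determinant (hankel_associated_form hf N_gt0 disc).
rewrite -/(cat_mx _) det_mulmx det_scalar => E; rewrite catalecticantE.
apply/eqP => c0; move: E; rewrite c0 mul0r => /esym/eqP.
by rewrite expf_eq0 /= invr_eq0 expf_eq0 pnatr_eq0.
Qed.

Variables (P : {mpoly K[N.+3]}) (k : nat) (Inv : {mpoly K[2]} -> K).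
Hypothesis InvE : forall f, forms_disc N.+2 f ->
  Inv f = P.@[fun i : 'I_N.+3 => bcoef N.+2 f i] / discriminant N.+2 f ^+ k.
Hypothesis Inv_inv : gl_invariant_on (@gl_act _) (forms_disc N.+2) Inv.

Local Notation r := (k * N.+1)%N.
Local Notation w := #|{: 'I_r * 'I_N.+2}|.

Lemma P_covariant (f : {mpoly K[2]}) (M : 'M[K]_2) : forms_disc N.+2 f -> M \in unitmx ->
  P.@[fun i : 'I_N.+3 => bcoef N.+2 (row_subst M f) i] =
  \det M ^+ w * P.@[fun i : 'I_N.+3 => bcoef N.+2 f i].
Proof.
move=> [hf disc] uM; have dM : \det M != 0 by rewrite -unitfE -unitmxE.
have fU : forms_disc N.+2 f by [].
have MfU : forms_disc N.+2 (row_subst M f).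
  split; first exact: row_subst_homog.
  by rewrite discriminant_subst // mulf_neq0 // expf_neq0.
have actE : gl_act (invmx M^T) f = row_subst M f.
  by rewrite /gl_act invmxK trmxK.
have uM' : invmx M^T \in unitmx by rewrite unitmx_inv unitmx_tr.
have := Inv_inv uM' fU; rewrite actE !InvE // discriminant_subst // exprMn -exprM.
(* r = k(d - 1) makes the number w of brackets equal to the exponent of [\det M] in the
   transformation of the k-th power of the discriminant. *)
have -> : (N.+1 * N.+2 * k = w)%N by rewrite card_prod !card_ord; lia.
set D := \det M ^+ w => E.
have DD0 : D * discriminant N.+2 f ^+ k != 0 by rewrite mulf_neq0 // expf_neq0.
rewrite -[LHS](divfK DD0) E mulrCA divfK //.
by rewrite expf_neq0.
Qed.

Variable lambda : {perm 'I_r * 'I_N.+1} -> K.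
Hypothesis lambdaE : forall phi,
  apolar w (mmap (@mpolyC _ _) (fun i : 'I_N.+3 => gen_coef N.+2 phi i) P) =
  \sum_sigma lambda sigma * contract sigma (wedge phi).

(** The combination found for P, with the adjugate in place of the Bezoutian: at F = A(f) the two
    matrices differ by the scalar (d - 1)^2 Cat(F). *)
Definition contract_adj F : K :=
  \sum_sigma lambda sigma * contract sigma (tens (\adj (cat_mx F))).

(** The k-th power inverts the constant in Delta(f) = disc_const / ((d-1)^(2(N+1)) Cat(A(f))). The
    denominator removes the r factors (d - 1)^2 brought in by the adjugate, and the w + 1 of
    [apolar_det]. *)
Definition scale_const : K :=
  (N.+1%:R ^+ 2 ^+ N.+1 / disc_const K N) ^+ k / (N.+1%:R ^+ 2 ^+ r * w.+1%:R).

Definition invariant_lift F : K :=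
  scale_const * catalecticant N F ^+ k * contract_adj F / catalecticant N F ^+ r.

Lemma invariant_lift_regular : regular_on (2 * N) (catalecticant N) invariant_lift.
Proof.
have nE : (2 * N = N + N)%N by rewrite mul2n -addnn.
have pcat : poly_mx (2 * N) cat_mx by rewrite /cat_mx nE; apply: poly_mx_hankel.
have pdet : poly_fun (2 * N) (fun F : {mpoly K[2]} => catalecticant N F).
  have [Q HQ] := poly_fun_det pcat; exists Q => F.
  by rewrite catalecticantE HQ.
have [Q HQ] : poly_fun (2 * N) (fun F =>
    scale_const * catalecticant N F ^+ k * contract_adj F).
  apply: poly_fun_mul.
    by apply: poly_fun_mul; [apply: poly_fun_cst | apply: poly_fun_exp].
  apply: poly_fun_sum => sigma; apply: poly_fun_mul; first exact: poly_fun_cst.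
  by apply: poly_fun_contract => i j; apply: poly_fun_tens; apply: poly_mx_adj.
by exists Q, r => F _; rewrite /invariant_lift HQ.
Qed.

Lemma adj_unit m (A : 'M[K]_m) : A \in unitmx -> \adj A = \det A *: invmx A.
Proof.
move=> uA; rewrite /invmx uA scalerA mulfV ?scale1r //.
by rewrite -unitfE -unitmxE.
Qed.

Lemma invariant_lift_invariant :
  gl_invariant_on (@gl_dual_act _) (forms_cat N) invariant_lift.
Proof.
move=> g F ug [hF catF]; rewrite mul2n -addnn in hF.
have uH : cat_mx F \in unitmx by rewrite unitmxE unitfE -catalecticantE.
have dg : \det g != 0 by rewrite -unitfE -unitmxE.
pose u := invmx g; have uu : u \in unitmx by rewrite unitmx_inv.
have du : \det u = (\det g)^-1 by rewrite det_inv.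
pose rho := symM N g; have urho : rho \in unitmx by apply: symM_unit.
have rhoV : symM N u = invmx rho.
  have E : symM N u *m rho = 1%:M by rewrite -symM_mul mulVmx // symM_1.
  by rewrite -[LHS](mulmxK urho) E mul1mx.
have HgE : cat_mx (gl_dual_act g F) = rho *m cat_mx F *m rho^T by exact: hankel_subst.
pose delta := \det rho ^+ 2.
have deltaE : delta = \det g ^+ (N * N.+1) by apply: symM_det.
have catE : catalecticant N (gl_dual_act g F) = delta * catalecticant N F.
  rewrite !catalecticantE HgE !det_mulmx det_tr /delta; ring.
have adjE : \adj (cat_mx (gl_dual_act g F)) =
    delta *: ((symM N u)^T *m \adj (cat_mx F) *m symM N u).
  rewrite !adj_unit // -?catalecticantE ?catE; last first.
    by rewrite HgE !unitmx_mul unitmx_tr uH urho.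
  rewrite -scalemxAr -scalemxAl scalerA; congr (_ *: _).
  rewrite rhoV HgE trmx_inv; have urT : rho^T \in unitmx by rewrite unitmx_tr.
  have uA : rho *m cat_mx F *m rho^T \in unitmx by rewrite !unitmx_mul urho uH urT.
  rewrite -[RHS](mulmxK uA); apply: (canRL (mulmxK uA)).
  rewrite mulVmx // !mulmxA (mulmxKV urho) -[invmx rho^T *m _ *m _]mulmxA mulVmx // mulmx1.
  by rewrite mulVmx.
have contractE (sigma : {perm 'I_r * 'I_N.+1}) : contract sigma (tens (\adj (cat_mx (gl_dual_act g F)))) =
    delta ^+ r * (\det u ^+ (r * N) * contract sigma (tens (\adj (cat_mx F)))).
  rewrite adjE (@eq_contract _ _ _ sigma _ (fun i j => delta *
    tens ((symM N u)^T *m \adj (cat_mx F) *m symM N u) i j)); last first.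
    by move=> i j _ _; rewrite tens_scale.
  rewrite contract_scale card_ord; congr (_ * _).
  (* [tens_symM] carries a factor [\det u], one for each of the r blocks, so both sides are first
     multiplied by [\det u ^+ r]. *)
  have du0 : \det u ^+ r != 0 by rewrite expf_neq0 // -unitfE -unitmxE.
  apply: (mulfI du0); rewrite mulrA -exprD -[r in \det u ^+ r * _]card_ord -contract_scale.
  rewrite (@contract_tensor _ _ _ sigma u^T (tens (\adj (cat_mx F)))).
    by rewrite det_tr card_prod !card_ord; congr (_ ^+ _ * _); lia.
  by move=> i j iN jN; rewrite -tens_symM.
have caE : contract_adj (gl_dual_act g F) = delta ^+ r * \det u ^+ (r * N) * contract_adj F.
  rewrite /contract_adj mulr_sumr; apply: eq_bigr => sigma _.
  by rewrite contractE; ring.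
rewrite /invariant_lift catE caE ![(delta * _) ^+ _]exprMn.
have d0 : delta != 0 by rewrite deltaE expf_neq0.
(* The factors [delta ^+ r] of [contract_adj] and of the denominator cancel; [delta ^+ k] from the
   numerator meets the powers of [\det u], and r = k(N + 1) balances the exponents. *)
have key : delta ^+ k * \det u ^+ (r * N) = 1.
  rewrite deltaE -exprM du exprVn; have -> : (N * N.+1 * k = r * N)%N by lia.
  by rewrite mulfV // expf_neq0.
rewrite invfM -[RHS]mul1r -key.
have dr : delta ^+ r != 0 by rewrite expf_neq0.
move: (delta ^+ k) (\det u ^+ _) (delta ^+ r) dr (catalecticant N F ^+ k)
  (contract_adj F) (catalecticant N F ^+ r)^-1 scale_const => a b c c0 x y z t.
by field.
Qed.

Lemma invariant_lift_associated (f : {mpoly K[2]}) : forms_disc N.+2 f ->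
  Inv f = invariant_lift (associated_form N.+2 f).
Proof.
move=> fU; have [hf disc] := fU; set F := associated_form _ _.
have n0 : N.+1%:R != 0 :> K by rewrite pnatr_eq0.
have HB : cat_mx F *m grad_bez N f = (N.+1%:R ^- 2)%:M := hankel_associated_form hf N_gt0 disc.
have uB : grad_bez N f \in unitmx := grad_bez_unit hf disc.
have [_ catF] : forms_cat N F := associated_form_cat fU.
have uH : cat_mx F \in unitmx by rewrite unitmxE unitfE -catalecticantE.
have adjE : \adj (cat_mx F) = (catalecticant N F * N.+1%:R ^+ 2) *: grad_bez N f.
  rewrite adj_unit // -catalecticantE -scalerA; congr (_ *: _).
  rewrite -[invmx _]mulmx1; have -> : 1%:M = N.+1%:R ^+ 2 *: (cat_mx F *m grad_bez N f).
    by rewrite HB scale_scalar_mx mulfV // expf_neq0.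
  by rewrite -scalemxAr mulKmx.
have caE : contract_adj F = (catalecticant N F * N.+1%:R ^+ 2) ^+ r *
    (w.+1%:R * P.@[fun i : 'I_N.+3 => bcoef N.+2 f i]).
  rewrite -(apolar_covariant hf (fun M uM => P_covariant fU uM)) lambdaE mulr_sumr.
  apply: eq_bigr => sigma _; rewrite adjE [RHS]mulrCA; congr (_ * _).
  rewrite (@eq_contract _ _ _ sigma _ (fun i j => (catalecticant N F * N.+1%:R ^+ 2) *
     wedge (ncoef N.+2 f) i j)); first by rewrite contract_scale card_ord.
  by move=> i j iN jN; rewrite tens_scale tens_grad_bez.
have discE : discriminant N.+2 f =
    disc_const K N / (N.+1%:R ^+ 2 ^+ N.+1 * catalecticant N F).
  rewrite (discriminantE hf); congr (_ * _).
  have := congr1 determinant HB; rewrite det_mulmx det_scalar -catalecticantE => E.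
  by rewrite invfM -exprVn -E mulrAC mulfV ?mul1r.
rewrite /invariant_lift caE InvE // discE /scale_const.
have k0 := disc_const_neq0 K N; have w0 : w.+1%:R != 0 :> K by rewrite pnatr_eq0.
have n20 : N.+1%:R ^+ 2 != 0 :> K by rewrite expf_neq0.
move: (P.@[_]) (disc_const K N) k0 (N.+1%:R ^+ 2) n20 (catalecticant N F) catF
  (w.+1%:R) w0 => x a a0 b b0 c c0 e e0.
have ak0 := expf_neq0 k a0; have bk0 := expf_neq0 k (expf_neq0 N.+1 b0).
have br0 := expf_neq0 r b0; have ck0 := expf_neq0 k c0; have cr0 := expf_neq0 r c0.
rewrite !exprMn !exprVn !exprMn.
move: (a ^+ k) (b ^+ N.+1 ^+ k) (b ^+ r) (c ^+ k) (c ^+ r) ak0 bk0 br0 ck0 cr0.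
move=> ak bk br ck cr *.
by field; do ?[apply/andP; split].
Qed.

End Main.

Theorem theorem1p2 (R : realType) (d : nat) (hd : (3 <= d)%N) :
  (forall f : {mpoly (complex R)[2]},
     forms_disc d f -> forms_cat (d - 2) (associated_form d f)) /\
  (forall I : {mpoly (complex R)[2]} -> complex R,
     regular_on d (discriminant d) I ->
     gl_invariant_on (@gl_act _) (forms_disc d) I ->
     exists J : {mpoly (complex R)[2]} -> complex R,
       [/\ regular_on (2 * (d - 2)) (catalecticant (d - 2)) J,
           gl_invariant_on (@gl_dual_act _) (forms_cat (d - 2)) J &
           forall f : {mpoly (complex R)[2]},
             forms_disc d f -> I f = J (associated_form d f)]).
Proof.
(* d = N + 2 with N > 0, the indexing of the preceding sections. *)
case: d hd => [|[|[|N']]] // _; set N := N'.+1.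
have -> : (N.+2 - 2 = N)%N by [].
split=> [f|Inv [P [k InvE]] Inv_inv]; first exact: associated_form_cat.
have [lambda lambdaE] := apolar_span 'I_(k * N.+1) P.
exists (invariant_lift lambda); split.
- exact: invariant_lift_regular.
- exact: invariant_lift_invariant.
- move=> f; exact: (@invariant_lift_associated _ N isT P).
Qed.
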